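(* Let $\Omega\subset\mathbb{R}^n$ be a bounded Lipschitz domain, let $\mu>0$, and for $s\in(0,1)$ let $$\mathcal{R}_s:L^2(\Omega)\to[0,\infty],\qquad\mathcal{R}_s(u)=\begin{cases}\mu\|(-\Delta_D)^{s/2}u\|^2_{L^2(\Omega)}&\text{for }u\in\mathbb{H}^s(\Omega),\\ \infty&\text{otherwise},\end{cases}$$ where $(-\Delta_D)^{s/2}$ is the spectral fractional Laplacian of order $s/2$ with Dirichlet boundary conditions on the space $\mathbb{H}^s(\Omega)$ (see context). Then, for every $s\in[0,1]$, the Mosco-limit $\overline{\mathcal{R}}_s:=\mathrm{Mosc}(L^2)\text{-}\lim_{s'\to s}\mathcal{R}_{s'}$ exists and, for all $u\in L^2(\Omega)$, $$\overline{\mathcal{R}}_s(u)=\begin{cases}\mathcal{R}_s(u)&\text{if }s\in(0,1),\\ \mu\|u\|^2_{L^2(\Omega)}&\text{if }s=0,\\ \mu\|\nabla u\|^2_{L^2(\Omega)}+\chi_{H^1_0(\Omega)}(u)&\text{if }s=1,\end{cases}$$ where $\chi_{H_0^1(\Omega)}(u)=0$ if $u\in H^1_0(\Omega)$ and $\chi_{H_0^1(\Omega)}(u)=\infty$ otherwise (so that for $s=1$ the value is $\infty$ whenever $u\notin H^1_0(\Omega)$).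
   Context: Let $(\psi_m)_{m\in\mathbb{N}}\subset H^1_0(\Omega)$ be a sequence of eigenfunctions of the Dirichlet Laplacian forming an orthonormal basis of $L^2(\Omega)$, with eigenvalues $0<\lambda_1\le\lambda_2\le\dots\nearrow\infty$: $(-\Delta)\psi_m=\lambda_m\psi_m$ in $\Omega$, $\psi_m=0$ on $\partial\Omega$. For $u\in L^2(\Omega)$ write $\hat u_m=\langle u,\psi_m\rangle_{L^2(\Omega)}$. For $s\in(0,1)$, $$\mathbb{H}^s(\Omega)=\Bigl\{u=\sum_{m=1}^\infty\hat u_m\psi_m\in L^2(\Omega):\sum_{m=1}^\infty\lambda_m^s\hat u_m^2<\infty\Bigr\},\qquad(-\Delta_D)^{s/2}u=\sum_{m=1}^\infty\lambda_m^{s/2}\hat u_m\psi_m\ \text{ for }u\in\mathbb{H}^s(\Omega).$$ Mosco-convergence: for $\mathcal{F}_k,\mathcal{F}:L^2(\Omega)\to[0,\infty]$, $\mathcal{F}=\mathrm{Mosc}(L^2)\text{-}\lim_k\mathcal{F}_k$ means: (liminf inequality) whenever $u_k\rightharpoonup u$ weakly in $L^2(\Omega)$, $\mathcal{F}(u)\le\liminf_k\mathcal{F}_k(u_k)$; and (limsup inequality) for every $u\in L^2(\Omega)$ there is a sequence $u_k\to u$ strongly in $L^2(\Omega)$ with $\mathcal{F}(u)\ge\limsup_k\mathcal{F}_k(u_k)$. The statement $\mathrm{Mosc}(L^2)\text{-}\lim_{s'\to s}\mathcal{R}_{s'}=\mathcal{F}$ means that $\mathrm{Mosc}(L^2)\text{-}\lim_k\mathcal{R}_{s_k}=\mathcal{F}$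 for every sequence $(s_k)_k\subset(0,1)$ with $s_k\to s$. *)

(* Defs.v *)
From HB Require Import structures.
From mathcomp Require Import all_boot all_order all_algebra.
From mathcomp Require Import all_classical all_reals all_analysis.
From mathcomp Require Import measurable_realfun.

Set Implicit Arguments.
Unset Strict Implicit.
Unset Printing Implicit Defensive.
Import Order.TTheory GRing.Theory Num.Theory.
Import numFieldNormedType.Exports.

Local Open Scope classical_set_scope.
Local Open Scope ring_scope.

(* R^n is 'rV[R]_n, with the sigma-algebra generated by the coordinates; it is
   the Borel one (see open_measurable_rV). *)
Definition measure_rV_display : measure_display.
Proof. exact: default_measure_display. Qed.

Section measurable_rV.
Context {R : realType} (n : nat).

Let coord (i : 'I_n) (x : 'rV[R]_n) : R := x 0 i.

Let rV_set0 : g_sigma_preimage coord set0.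
Proof. exact: sigma_algebra0. Qed.

Let rV_setC A : g_sigma_preimage coord A -> g_sigma_preimage coord (~` A).
Proof. exact: sigma_algebraC. Qed.

Let rV_bigcup (F : (set 'rV[R]_n)^nat) :
  (forall i, g_sigma_preimage coord (F i)) ->
  g_sigma_preimage coord (\bigcup_i F i).
Proof. exact: sigma_algebra_bigcup. Qed.

HB.instance Definition _ := @isMeasurable.Build measure_rV_display
  'rV[R]_n (g_sigma_preimage coord) rV_set0 rV_setC rV_bigcup.

Lemma measurable_coord (i : 'I_n) :
  measurable_fun [set: 'rV[R]_n] (fun x => x 0 i : R).
Proof.
move=> _ Y mY; rewrite setTI; apply: sub_sigma_algebra => /=.
rewrite -bigcup_seq/=; exists i => /=; first by rewrite mem_index_enum.
by exists Y => //; rewrite setTI.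
Qed.

Lemma measurable_fun_rV d (T : measurableType d) (f : T -> 'rV[R]_n) :
  (forall i, measurable_fun [set: T] (fun x => f x 0 i : R)) ->
  measurable_fun [set: T] f.
Proof.
move=> mf _ Y mY; rewrite setTI.
have : g_sigma_preimage coord `<=` [set B | measurable (f @^-1` B)].
  apply: smallest_sub.
    split=> /= [|A mA|F mF].
    - by rewrite preimage_set0; exact: measurable0.
    - by rewrite setTD preimage_setC; exact: measurableC.
    - by rewrite preimage_bigcup; exact: bigcup_measurable.
  move=> A; rewrite -bigcup_seq/= => -[i _ [B mB <-]] /=.
  by rewrite setTI -comp_preimage -[X in measurable X]setTI; exact: (mf i).
by apply.
Qed.

End measurable_rV.

Lemma open_measurable_rV (R : realType) (n : nat) (A : set 'rV[R]_n) :
  open A -> measurable A.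
Proof.
move=> oA.
pose B (p : 'rV[rat]_n * rat) : set 'rV[R]_n :=
  [set x | forall i, `|ratr (p.1 0 i) - x 0 i| < ratr p.2].
pose F p := if `[< B p `<=` A >] then B p else set0.
have -> : A = \bigcup_p F p.
  apply/seteqP; split => [x Ax|x [p _]]; last first.
    by rewrite /F; case: asboolP => [BA /BA|_ []].
  have : nbhs x A by move: oA; rewrite openE; exact.
  rewrite -nbhs_ballE => -[e /= e0 xeA].
  have [r /[!in_itv]/= /andP[r0 re]] := rat_in_itvoo (divr_gt0 e0 (ltr0Sn R 1)).
  have q (i : 'I_n) : {q : rat | `|ratr q - x 0 i| < ratr r}.
    apply: cid; have : x 0 i - ratr r < x 0 i + ratr r.
      by rewrite ltrD2l gtrN.
    move=> /rat_in_itvoo[y]; rewrite in_itv/= => /andP[y1 y2].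
    by exists y; rewrite ltr_distl y1.
  pose p := (\row_i sval (q i), r).
  have xB : B p x by move=> i; rewrite mxE; exact: (svalP (q i)).
  exists p => //; rewrite /F; case: asboolP => [//|[]] y yB.
  apply: xeA; split => // j i; rewrite !ord1.
  rewrite /ball/= (splitr e) -(subrKA (ratr (p.1 0 i))).
  rewrite (le_lt_trans (ler_normD _ _))// ltrD//.
  - by rewrite distrC (lt_trans (xB i)).
  - by rewrite (lt_trans (yB i)).
apply: countable_bigcupT_measurable => // p.
rewrite /F; case: asboolP => _; last exact: measurable0.
have -> : B p = \big[setI/setT]_(i < n)
    [set x : 'rV[R]_n | `|ratr (p.1 0 i) - x 0 i| < ratr p.2].
  rewrite -bigcap_seq; apply/seteqP; split => [x Bx i _|x Bx i]; first exact: Bx.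
  by apply: Bx; rewrite /= mem_index_enum.
apply: bigsetI_measurable => i _.
rewrite -[X in measurable X]setTI.
pose ball_i : set R := [set t | `|ratr (p.1 0 i) - t| < ratr p.2].
apply: (measurable_coord i measurableT (Y := ball_i)).
have -> : ball_i = ball (ratr (p.1 0 i) : R) (ratr p.2) by [].
exact: measurable_ball.
Qed.

Section rV_cons.
Context {R : realType} (n : nat).

Definition rV_cons (tx : measurableTypeR R * 'rV[R]_n) : 'rV[R]_n.+1 :=
  row_mx (const_mx tx.1 : 'rV_1) tx.2.

Definition rV_uncons (x : 'rV[R]_n.+1) : measurableTypeR R * 'rV[R]_n :=
  (x 0 ord0, rsubmx (x : 'rV_(1 + n))).

Lemma rV_consK : cancel rV_cons rV_uncons.
Proof.
case=> t x; rewrite /rV_cons /rV_uncons row_mxKr/=; congr pair.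
rewrite -[RHS](_ : row_mx (const_mx t : 'rV_1) x 0 (lshift n ord0) = t).
  by congr (row_mx _ _ _ _); exact/val_inj.
by rewrite row_mxEl mxE.
Qed.

Lemma rV_cons0 tx : rV_cons tx 0 ord0 = tx.1.
Proof. by have := congr1 fst (rV_consK tx). Qed.

Lemma rV_consS tx i : rV_cons tx 0 (lift ord0 i) = tx.2 0 i.
Proof.
rewrite -[RHS](row_mxEr (const_mx tx.1 : 'rV_1)).
by congr (row_mx _ _ _ _); exact/val_inj.
Qed.

Lemma measurable_rV_cons : measurable_fun setT rV_cons.
Proof.
apply: measurable_fun_rV => i; have [j ->|->] := unliftP ord0 i.
- rewrite [X in measurable_fun _ X](_ : _ =
      (fun x : 'rV[R]_n => x 0 j : R) \o snd).
    exact: measurableT_comp (measurable_coord j) measurable_snd.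
  by apply/funext => tx /=; rewrite rV_consS.
- rewrite [X in measurable_fun _ X](_ : _ = fst); first exact: measurable_fst.
  by apply/funext => tx /=; rewrite rV_cons0.
Qed.

Lemma measurable_rV_uncons : measurable_fun setT rV_uncons.
Proof.
apply: measurable_fun_pair; first exact: measurable_coord.
apply: measurable_fun_rV => i.
rewrite [X in measurable_fun _ X](_ : _ =
    (fun x : 'rV[R]_n.+1 => x 0 (rshift 1 i) : R)).
  exact: measurable_coord.
by apply/funext => x; rewrite mxE.
Qed.

End rV_cons.


Section lebesgue_rVS.
Context {R : realType} (n : nat).
Variable m : {sigma_finite_measure set 'rV[R]_n -> \bar R}.

Let prod_m := (@lebesgue_measure R \x m)%E.

Definition lebesgue_rVS : set 'rV[R]_n.+1 -> \bar R :=
  pushforward (@lebesgue_measure R \x m)%E (@rV_cons R n).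

Let mcons := @measurable_rV_cons R n.

Let lebesgue_rVS0 : lebesgue_rVS set0 = 0%E.
Proof. by rewrite /lebesgue_rVS /pushforward preimage_set0 measure0. Qed.

Let lebesgue_rVS_ge0 A : (0 <= lebesgue_rVS A)%E.
Proof. exact: measure_ge0. Qed.

Let lebesgue_rVS_sigma_additive : semi_sigma_additive lebesgue_rVS.
Proof.
exact: (@measure_semi_sigma_additive _ _ _
  (measure_function_pushforward__canonical__measure_function_Measure prod_m mcons)).
Qed.

HB.instance Definition _ := isMeasure.Build _ _ _ lebesgue_rVS
  lebesgue_rVS0 lebesgue_rVS_ge0 lebesgue_rVS_sigma_additive.

Let lebesgue_rVS_sigma_finite : sigma_finite setT lebesgue_rVS.
Proof.
have /sigma_finiteP[F [TF ndF Foo]] := sigma_finiteT (@lebesgue_measure R).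
have /sigma_finiteP[G [TG ndG Goo]] := sigma_finiteT m.
exists (fun k => @rV_uncons R n @^-1` (F k `*` G k)).
  rewrite -preimage_bigcup; apply/seteqP; split => // x _ /=.
  have [i _ Fi] : (\bigcup_k F k) (rV_uncons x).1 by rewrite -TF.
  have [j _ Gj] : (\bigcup_k G k) (rV_uncons x).2 by rewrite -TG.
  exists (maxn i j) => //; split.
  - by move: Fi; exact/subsetPset/ndF/leq_maxl.
  - by move: Gj; exact/subsetPset/ndG/leq_maxr.
move=> k; have [mFk Fk] := Foo k; have [mGk Gk] := Goo k; split.
  rewrite -[X in measurable X]setTI.
  by apply: measurable_rV_uncons => //; exact: measurableX.
rewrite /lebesgue_rVS /pushforward -comp_preimage.
rewrite [X in X @^-1` _](_ : _ = id); last exact/funext/rV_consK.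
by rewrite product_measure1E// lte_mul_pinfty// ge0_fin_numE.
Qed.

HB.instance Definition _ := Measure_isSigmaFinite.Build _ _ _ lebesgue_rVS
  lebesgue_rVS_sigma_finite.

End lebesgue_rVS.

Fixpoint lebesgue_rV (R : realType) (n : nat) :
    {sigma_finite_measure set 'rV[R]_n -> \bar R} :=
  if n is n'.+1 then lebesgue_rVS (lebesgue_rV R n') else \d_(0 : 'rV[R]_0).

Lemma lebesgue_rV_box (R : realType) (n : nat) (A : 'I_n -> set R) :
  (forall i, measurable (A i)) ->
  lebesgue_rV R n [set x | forall i, A i (x 0 i)] =
  (\prod_(i < n) lebesgue_measure (A i))%E.
Proof.
elim: n A => [|n IH] A mA.
  by rewrite big_ord0 /= diracE mem_set//= => -[].
rewrite big_ord_recl -IH//= /lebesgue_rVS /pushforward.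
pose B : set 'rV[R]_n := [set x | forall i, A (lift ord0 i) (x 0 i)].
have mB : measurable B.
  have -> : B = \big[setI/setT]_(i < n)
      [set x : 'rV[R]_n | A (lift ord0 i) (x 0 i)].
    rewrite -bigcap_seq; apply/seteqP; split => [x Bx i _|x Bx i]; first exact: Bx.
    by apply: Bx; rewrite /= mem_index_enum.
  apply: bigsetI_measurable => i _; rewrite -[X in measurable X]setTI.
  exact: (measurable_coord i measurableT (Y := A (lift ord0 i))).
transitivity ((@lebesgue_measure R \x lebesgue_rV R n)%E (A ord0 `*` B));
  last by rewrite product_measure1E//; exact: mA.
congr (product_measure1 _ _ _).
apply/seteqP; split => [tx Atx|tx [A0 BS] i] /=.
  split; first by have := Atx ord0; rewrite rV_cons0.
  by move=> i; have := Atx (lift ord0 i); rewrite rV_consS.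
by have [j ->|->] := unliftP ord0 i; rewrite ?rV_consS ?rV_cons0.
Qed.

(* Near each boundary point, after an orthogonal change of coordinates Q, Omega
   is the region above the graph of a Lipschitz function gamma of all the
   coordinates but the j-th. *)
Definition lipschitz_boundary (R : realType) (n : nat) (Omega : set 'rV[R]_n) :=
  forall x, closure Omega x -> ~ Omega x ->
  exists (Q : 'M[R]_n) (j : 'I_n) (gamma : 'rV[R]_n.-1 -> R),
    [/\ Q *m Q^T = 1%:M, lipschitz gamma &
      \forall y \near x,
        Omega y <-> gamma (col' j (y *m Q)) < (y *m Q) 0 j].

Record lipschitz_domain (R : realType) (n : nat) := LipschitzDomain {
  domain_set :> set 'rV[R]_n;
  domain_nonempty : domain_set !=set0;
  domain_open : open domain_set;
  domain_connected : connected domain_set;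
  domain_bounded : bounded_set domain_set;
  domain_lipschitz : lipschitz_boundary domain_set }.

Definition lebesgue_on (R : realType) (n : nat) (Omega : lipschitz_domain R n) :
    {measure set 'rV[R]_n -> \bar R} :=
  mrestr (lebesgue_rV R n) (open_measurable_rV (@domain_open _ _ Omega)).

(* Elements are functions, not classes of functions modulo a.e. equality; all
   the notions below are invariant under a.e. equality on Omega. *)
Definition L2 (R : realType) (n : nat) (Omega : lipschitz_domain R n) :=
  LfunType (lebesgue_on Omega) (lee1n 2).

Section L2_theory.
Context {R : realType} {n : nat} {Omega : lipschitz_domain R n}.
Implicit Types u v w : L2 Omega.

Definition ip u v : R := \int[lebesgue_on Omega]_x (u x * v x).

Definition L2norm u : R := fine ('N[lebesgue_on Omega]_2%:E[EFin \o u])%E.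

Definition L2cvg (u_ : nat -> L2 Omega) u :=
  (fun k => L2norm (u_ k - u)) @ \oo --> (0 : R).

Definition L2weak_cvg (u_ : nat -> L2 Omega) u :=
  forall v, (fun k => ip (u_ k) v) @ \oo --> ip u v.

(* The value is unspecified if the series diverges in L^2(Omega); otherwise it
   is a representative of the sum. *)
Definition L2series (f : nat -> L2 Omega) : L2 Omega :=
  xget 0 [set w | L2cvg (fun N => \sum_(m < N) f m) w].

Definition unit_vec (i : 'I_n) : 'rV[R]_n := delta_mx 0 i.

Definition smooth (phi : 'rV[R]_n -> R) :=
  forall s : seq 'I_n,
    let dphi := foldr (fun i f => 'D_(unit_vec i) f) phi s in
    continuous dphi /\ forall i x, derivable dphi x (unit_vec i).

Definition test_function (phi : 'rV[R]_n -> R) :=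
  [/\ smooth phi, compact (closure [set x | phi x != 0]) &
      closure [set x | phi x != 0] `<=` Omega].

Definition is_weak_partial (i : 'I_n) u (g : L2 Omega) :=
  forall phi, test_function phi ->
    \int[lebesgue_on Omega]_x (u x * 'D_(unit_vec i) phi x) =
    - \int[lebesgue_on Omega]_x (g x * phi x).

Definition H1 : set (L2 Omega) :=
  [set u | forall i, exists g, is_weak_partial i u g].

(* A representative of the i-th component of the weak gradient of u in H1; it is
   unspecified if there is none. *)
Definition weak_partial (i : 'I_n) u : L2 Omega :=
  xget 0 [set g | is_weak_partial i u g].

Definition grad_ip u v : R :=
  \sum_(i < n) ip (weak_partial i u) (weak_partial i v).

Definition grad_sqnorm u : R := \sum_(i < n) L2norm (weak_partial i u) ^+ 2.

Definition H1norm u : R := Num.sqrt (L2norm u ^+ 2 + grad_sqnorm u).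

(* H^1_0(Omega) is the closure of C_c^oo(Omega) in H^1(Omega). *)
Definition H10 : set (L2 Omega) :=
  [set u | H1 u /\ exists phi_ : nat -> L2 Omega,
    (forall k, test_function (phi_ k)) /\
    (fun k => H1norm (phi_ k - u)) @ \oo --> (0 : R)].

(* The eigenvalue equation is the weak one, tested on H^1_0(Omega). Indices start
   from 0. *)
Record dirichlet_eigenbasis (psi : nat -> L2 Omega) (lam : nat -> R) : Prop := {
  eigen_H10 : forall m, H10 (psi m);
  eigen_eq : forall m v, H10 v -> grad_ip (psi m) v = lam m * ip (psi m) v;
  eigen_orthonormal : forall l m, ip (psi l) (psi m) = (l == m)%:R;
  eigen_basis : forall u,
    L2cvg (fun N => \sum_(m < N) ip u (psi m) *: psi m) u;
  eigen_gt0 : 0 < lam 0;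
  eigen_nondecreasing : nondecreasing_seq lam;
  eigen_cvg : lam @ \oo --> +oo }.

Variables (psi : nat -> L2 Omega) (lam : nat -> R).

Definition Hs (s : R) : set (L2 Omega) :=
  [set u | \sum_(0 <= m <oo) (lam m `^ s * ip u (psi m) ^+ 2)%:E < +oo]%E.

(* frac_laplacian t is (-Delta_D)^t, to be applied on Hs (2 * t). *)
Definition frac_laplacian (t : R) u : L2 Omega :=
  L2series (fun m => (lam m `^ t * ip u (psi m)) *: psi m).

Definition frac_energy (mu s : R) u : \bar R :=
  if u \in Hs s then (mu * L2norm (frac_laplacian (s / 2) u) ^+ 2)%:E
  else +oo%E.

Definition mosco_lim (F_ : nat -> L2 Omega -> \bar R) (F : L2 Omega -> \bar R) :=
  (forall (u_ : nat -> L2 Omega) u, L2weak_cvg u_ u ->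
    (F u <= limn_einf (fun k => F_ k (u_ k)))%E) /\
  (forall u, exists u_ : nat -> L2 Omega, L2cvg u_ u /\
    (limn_esup (fun k => F_ k (u_ k)) <= F u)%E).

(* The limit is along all sequences in ]0, 1[ tending to s, which may take the
   value s. *)
Definition mosco_lim_at (F_ : R -> L2 Omega -> \bar R) (s : R)
    (F : L2 Omega -> \bar R) :=
  forall s_ : nat -> R, (forall k, 0 < s_ k < 1) -> s_ @ \oo --> s ->
    mosco_lim (fun k => F_ (s_ k)) F.

Definition chi (A : set (L2 Omega)) u : \bar R :=
  if u \in A then 0%E else +oo%E.

End L2_theory.

(* Main.v *)
Require Import Defs.
From mathcomp Require Import all_boot all_order all_algebra.
From mathcomp Require Import all_classical all_reals all_analysis.
From mathcomp Require Import measurable_realfun.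
From mathcomp Require Import ring lra.

Set Implicit Arguments.
Unset Strict Implicit.
Unset Printing Implicit Defensive.
Import Order.TTheory GRing.Theory Num.Theory.
Import numFieldNormedType.Exports.
Local Open Scope classical_set_scope.
Local Open Scope ring_scope.

(** Expand everything in the eigenbasis: with [u_m = ip u (psi m)], all the
energies in play are instances of one formula,
  [E_s(u) = mu * \sum_m lam_m ^ s * u_m ^ 2], with values in [0, +oo].
For [0 < s < 1] this is Parseval's identity for the spectral fractional
Laplacian, together with the Riesz-Fischer theorem, which says that the series
defining that operator converges when the energy is finite ([frac_energyE]).
For [s = 0] it is Parseval's identity ([parseval]).  For [s = 1] it is the
characterization of H^1_0 and of the Dirichlet integral by the coefficients
([dirichlet_energyE]).  It remains to prove that [E_(s_k)] Mosco-converges to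
[E_s] when [s_k] tends to [s] ([spectral_mosco]).

Both halves of this convergence are statements about weighted square sums.
Liminf inequality: weak convergence gives convergence of each coefficient, so
each partial sum converges, and the supremum of the limits of the partial sums
is [E_s(u)].  Limsup inequality: multiply the m-th coefficient of [u] by
[min 1 (lam_m ^ ((s - s_k) / 2))].  The modified function has an [E_(s_k)] which
never exceeds [E_s(u)], and it tends to [u] in L^2 by dominated convergence of
the sum of the squared errors.

The case [s = 1] is where the domain and the weak derivatives enter.  The
gradients of the eigenfunctions are orthogonal with squared norms [lam_m].
Bessel's inequality for them bounds the sum of the [lam_m * u_m ^ 2] by the
Dirichlet integral of a function of H^1_0 ([dirichlet_bessel]).  Conversely, if
this sum is finite, the gradients of the partial sums of the expansion of [u]
form a Cauchy sequence; L^2 is complete ([L2_complete]), so they converge, the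
limit is the weak gradient of [u], and [u] is in H^1_0 because H^1_0 is closed
([finite_energy_H10]).  Two facts about test functions support this.
Integration by parts, proved by induction on the dimension from Fubini's theorem
and the fundamental theorem of calculus, says that test functions are in H^1
([test_ibp]).  Weak derivatives are unique because test functions are total in
L^2 ([test_functions_total]), and this needs no mollification here: the
eigenfunctions form a basis of L^2 and are limits of test functions. *)

(** * Geometry of L^2 *)

Lemma cvg_sumr (R : realType) I (r : seq I) (P : pred I) (f : I -> nat -> R)
    (l : I -> R) :
  (forall i, P i -> f i @ \oo --> l i) ->
  (fun k => \sum_(i <- r | P i) f i k) @ \oo --> \sum_(i <- r | P i) l i.
Proof. by move=> fl; apply: cvg_big => //; exact: add_continuous. Qed.

Lemma cvg0_le (R : realType) (f g : R^nat) : (forall k, 0 <= f k <= g k) ->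
  g @ \oo --> (0 : R) -> f @ \oo --> (0 : R).
Proof.
move=> fg g0; apply: (squeeze_cvgr _ (cvg_cst 0) g0).
exact: nearW.
Qed.

Section L2_geometry.
Context {R : realType} {n : nat} {Omega : lipschitz_domain R n}.
Implicit Types u v w : L2 Omega.
Local Notation mu := (lebesgue_on Omega).

Lemma integrable_mulL2 u v :
  mu.-integrable setT (fun x => (u x * v x)%:E).
Proof. by apply/Lfun1_integrable/Lfun2_mul_Lfun1; exact: LfunP. Qed.

Lemma ipC u v : ip u v = ip v u.
Proof. by apply: eq_Rintegral => x _; rewrite mulrC. Qed.

Lemma ipDl u v w : ip (u + v) w = ip u w + ip v w.
Proof.
rewrite /ip -RintegralD//; try exact: integrable_mulL2.
by apply: eq_Rintegral => x _; rewrite -mulrDl.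
Qed.

Lemma ipZl a u w : ip (a *: u) w = a * ip u w.
Proof.
rewrite /ip -RintegralZl//; try exact: integrable_mulL2.
by apply: eq_Rintegral => x _; rewrite mulrA.
Qed.

Lemma ipNl u w : ip (- u) w = - ip u w.
Proof. by rewrite -scaleN1r ipZl mulN1r. Qed.

Lemma ipBl u v w : ip (u - v) w = ip u w - ip v w.
Proof. by rewrite ipDl ipNl. Qed.

Lemma ip0l w : ip 0 w = 0.
Proof. by rewrite -(scale0r 0) ipZl mul0r. Qed.

Lemma ipZr a u w : ip w (a *: u) = a * ip w u.
Proof. by rewrite !(ipC w) ipZl. Qed.

Lemma ipBr u v w : ip w (u - v) = ip w u - ip w v.
Proof. by rewrite !(ipC w) ipBl. Qed.

Lemma ip_suml I (r : seq I) (P : pred I) (F : I -> L2 Omega) w :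
  ip (\sum_(i <- r | P i) F i) w = \sum_(i <- r | P i) ip (F i) w.
Proof.
elim/big_rec2: _ => [|i y1 y2 _ <-]; first exact: ip0l.
by rewrite ipDl.
Qed.

Lemma ip_sumr I (r : seq I) (P : pred I) (F : I -> L2 Omega) w :
  ip w (\sum_(i <- r | P i) F i) = \sum_(i <- r | P i) ip w (F i).
Proof. by rewrite ipC ip_suml; apply: eq_bigr => i _; rewrite ipC. Qed.

Lemma L2norm_ge0 u : 0 <= L2norm u.
Proof. by rewrite fine_ge0// Lnorm_ge0. Qed.

Lemma L2norm_sqr u : L2norm u ^+ 2 = ip u u.
Proof.
rewrite -powR_mulrn ?L2norm_ge0// /L2norm -fine_poweR poweR_Lnorm//.
congr fine; apply: eq_integral => x _.
by rewrite /= powR_mulrn// real_normK ?num_real// expr2.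
Qed.

Lemma ip_ge0 u : 0 <= ip u u.
Proof. by rewrite -L2norm_sqr sqr_ge0. Qed.

Lemma L2normE u : L2norm u = Num.sqrt (ip u u).
Proof. by rewrite -L2norm_sqr sqrtr_sqr ger0_norm// L2norm_ge0. Qed.

Lemma L2normD u v : L2norm (u + v) <= L2norm u + L2norm v.
Proof. exact: ler_LnormD. Qed.

Lemma L2normZ a u : L2norm (a *: u) = `|a| * L2norm u.
Proof.
rewrite !L2normE ipZl ipZr mulrA -expr2 sqrtrM ?sqr_ge0//.
by rewrite sqrtr_sqr.
Qed.

Lemma L2normN u : L2norm (- u) = L2norm u.
Proof. by rewrite -scaleN1r L2normZ normrN1 mul1r. Qed.

Lemma L2normB u v : L2norm (u - v) = L2norm (v - u).
Proof. by rewrite -opprB L2normN. Qed.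

Lemma L2norm_sub_trans w u v :
  L2norm (u - v) <= L2norm (u - w) + L2norm (w - v).
Proof. by rewrite -(subrKA w) L2normD. Qed.

(** The Cauchy-Schwarz inequality.  The case of a null [v], which need
not be the zero function, is treated apart. *)
Lemma ip_le u v : ip u v <= L2norm u * L2norm v.
Proof.
have [v0|v0] := eqVneq (L2norm v) 0; last first.
  have {v0} v_gt0 : 0 < L2norm v by rewrite lt_neqAle eq_sym v0 L2norm_ge0.
  have := ip_ge0 (L2norm v ^+ 2 *: u - ip u v *: v).
  rewrite !(ipBl, ipBr, ipZl, ipZr) -!L2norm_sqr (ipC v u).
  set a := L2norm u; set b := L2norm v; set c := ip u v => h.
  have a0 : 0 <= a := L2norm_ge0 u.
  have : 0 <= b ^+ 2 * (a ^+ 2 * b ^+ 2 - c ^+ 2) by apply: le_trans h _; nra.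
  rewrite pmulr_rge0 ?exprn_gt0// subr_ge0 -exprMn => {}h.
  apply: le_trans (ler_norm _) _.
  rewrite -(@ler_pXn2r _ 2)// ?nnegrE ?mulr_ge0 ?L2norm_ge0//.
  by rewrite real_normK ?num_real.
rewrite v0 mulr0.
(* The polynomial [t |-> ip (u - t *: v) (u - t *: v)] is affine when v is null;
   being nonnegative, it has no slope. *)
have hh (t : R) : t * ip u v *+ 2 <= ip u u.
  have := ip_ge0 (u - t *: v).
  rewrite !(ipBl, ipBr, ipZl, ipZr) -(L2norm_sqr v) v0 (ipC v u).
  by move=> h; lra.
rewrite leNgt; apply/negP => c0.
have := hh (ip u u / ip u v + (ip u v)^-1).
rewrite mulrDl divfK ?gt_eqF// mulVf ?gt_eqF//.
have := ip_ge0 u; lra.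
Qed.

Lemma ip_abs_le u v : `|ip u v| <= L2norm u * L2norm v.
Proof.
rewrite ler_norml ip_le andbT lerNl -ipNl.
by rewrite (le_trans (ip_le _ _))// L2normN.
Qed.

Lemma L2cvg_ip (u_ : nat -> L2 Omega) u v :
  L2cvg u_ u -> (fun k => ip (u_ k) v) @ \oo --> ip u v.
Proof.
move=> uu; apply/subr_cvg0; apply/norm_cvg0P.
apply: (@cvg0_le _ _ (fun k => L2norm (u_ k - u) * L2norm v)).
  by move=> k; rewrite normr_ge0/= -ipBl ip_abs_le.
by rewrite -[0](mul0r (L2norm v)); apply: cvgMr_tmp.
Qed.

Lemma L2cvg_norm (u_ : nat -> L2 Omega) u :
  L2cvg u_ u -> (fun k => L2norm (u_ k)) @ \oo --> L2norm u.
Proof.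
move=> uu; apply/subr_cvg0; apply/norm_cvg0P.
apply: cvg0_le uu => k; rewrite normr_ge0/= ler_norml lerNl opprB !lerBlDr.
have := L2normD (u - u_ k) (u_ k); have := L2normD (u_ k - u) u.
by rewrite !subrK (L2normB u) => -> ->.
Qed.

(** Functions that agree almost everywhere, which may be distinct elements
of [L2 Omega], cannot be told apart by the inner product. *)
Lemma ip_null u v w : L2norm (u - v) = 0 -> ip u w = ip v w.
Proof.
move=> uv; apply/eqP; rewrite -subr_eq0 -ipBl -normr_le0.
by rewrite (le_trans (ip_abs_le _ _))// uv mul0r.
Qed.

End L2_geometry.

(** * Lower and upper limits, series of nonnegative terms *)

Section limn_ereal.
Context {R : realType}.
Local Open Scope ereal_scope.
Implicit Types (u : (\bar R)^nat) (c : \bar R).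

Lemma limn_esup_le_near u c :
  (\forall k \near \oo, u k <= c) -> limn_esup u <= c.
Proof.
move=> uc; apply: (@le_trans _ _ (ereal_sup (u @` [set k | u k <= c]))).
  by apply: ereal_inf_lbound; exists [set k | u k <= c].
by apply: ge_ereal_sup => _ [k kc <-].
Qed.

Lemma limn_einf_ge_near u c :
  (\forall k \near \oo, c <= u k) -> c <= limn_einf u.
Proof.
move=> uc; rewrite /limn_einf leeNr; apply: limn_esup_le_near.
by apply: filterS uc => k ck /=; rewrite leeN2.
Qed.

Lemma limn_einf_le_near u c :
  (\forall k \near \oo, u k <= c) -> limn_einf u <= c.
Proof.
by move=> uc; apply: le_trans (limn_einf_sup u) (limn_esup_le_near uc).
Qed.

End limn_ereal.

Lemma le_limn_einf (R : realType) (u v : (\bar R)^nat) :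
  (forall k, u k <= v k)%E -> (limn_einf u <= limn_einf v)%E.
Proof.
move=> uv; rewrite !limn_einf_lim.
apply: lee_lim; [exact: is_cvg_einfs|exact: is_cvg_einfs|apply: nearW => N].
apply: le_ereal_inf_tmp => _ [k /= Nk <-].
by apply: le_trans (uv k); apply: ereal_inf_lbound; exists k.
Qed.

Lemma nneseries_EFin_le (R : realType) (a : R^nat) (C : R) :
  (forall k, 0 <= a k) -> (forall N, \sum_(0 <= k < N) a k <= C) ->
  (\sum_(0 <= k <oo) (a k)%:E <= C%:E)%E.
Proof.
move=> a0 aC; apply: lime_le.
  by apply: is_cvg_nneseries => k _ _; rewrite lee_fin.
by apply: nearW => N; rewrite sumEFin lee_fin.
Qed.

Lemma nneseries_EFinP (R : realType) (a : R^nat) (l : R) :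
  (forall k, 0 <= a k) ->
  (\sum_(0 <= k <oo) (a k)%:E = l%:E)%E <->
  (fun N => \sum_(k < N) a k) @ \oo --> l.
Proof.
move=> a0.
have E : (fun N => (\sum_(0 <= k < N) (a k)%:E)%E) =
    (fun N => (\sum_(k < N) a k)%:E).
  by apply/funext => N; rewrite sumEFin big_mkord.
split=> [al|al].
  have : (fun N => (\sum_(k < N) a k)%:E) @ \oo --> l%:E.
    rewrite -E -al; apply: is_cvg_nneseries => k _ _.
    by rewrite lee_fin.
  by move/fine_cvgP => -[].
rewrite E; apply/cvg_lim => //; apply: cvg_EFin => //.
exact: nearW.
Qed.

Lemma nneseries_fin_cvg (R : realType) (a : R^nat) :
  (forall k, 0 <= a k) -> (\sum_(0 <= k <oo) (a k)%:E < +oo)%E ->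
  exists2 l, (\sum_(0 <= k <oo) (a k)%:E = l%:E)%E &
    (fun N => \sum_(k < N) a k) @ \oo --> l.
Proof.
move=> a0 aoo.
have : (0 <= \sum_(0 <= k <oo) (a k)%:E)%E.
  by apply: nneseries_ge0 => k _ _; rewrite lee_fin.
case E : (\sum_(0 <= k <oo) (a k)%:E)%E aoo => [l| |]// _ _.
by exists l => //; apply/nneseries_EFinP.
Qed.

Lemma partial_sum_le (R : realType) (a : R^nat) (l : R) :
  (forall k, 0 <= a k) -> (fun N => \sum_(k < N) a k) @ \oo --> l ->
  forall N, \sum_(k < N) a k <= l.
Proof.
move=> a0 al N.
have ndec : nondecreasing_seq (fun N => \sum_(k < N) a k).
  by apply/nondecreasing_seqP => j; rewrite big_ord_recr/= lerDl.
have cl : cvgn (fun N => \sum_(k < N) a k) by apply/cvg_ex; exists l.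
by have := nondecreasing_cvgn_le ndec cl N; rewrite (cvg_lim _ al).
Qed.

(** * Completeness of L^2 *)

Section L2_completeness.
Context {R : realType} {n : nat} {Omega : lipschitz_domain R n}.
Implicit Types u v w : L2 Omega.
Local Notation mu := (lebesgue_on Omega).

Lemma integral_sqr_L2 u :
  (\int[mu]_x ((u x) ^+ 2)%:E = (L2norm u ^+ 2)%:E)%E.
Proof.
rewrite L2norm_sqr /ip /Rintegral fineK; last first.
  by apply: integrable_fin_num => //; exact: integrable_mulL2.
by apply: eq_integral => x _; rewrite expr2.
Qed.

Lemma integral_sqr_Lfun2 (f : 'rV[R]_n -> R) :
  measurable_fun setT f -> (\int[mu]_x ((f x) ^+ 2)%:E < +oo)%E ->
  f \in Lfun mu 2%:E.
Proof.
move=> mf foo; rewrite inE; apply/andP; split; first by rewrite inE.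
rewrite inE/= /finite_norm unlock poweR_lty//.
apply: le_lt_trans foo; rewrite le_eqVlt; apply/orP; left; apply/eqP.
apply: eq_integral => x _.
by rewrite /= powR_mulrn// real_normK ?num_real.
Qed.

Lemma geometric_steps_cvg (a : R^nat) (C : R) :
  (forall k, `|a k.+1 - a k| <= C * 2^-1 ^+ k) -> cvgn a.
Proof.
move=> h.
have : cvgn (series (telescope a)).
  apply: normed_cvg; apply: (@series_le_cvg _ _ (geometric C 2^-1)) => //=.
  - by move=> k; apply: le_trans (h k).
  - by apply: is_cvg_geometric_series; rewrite ger0_norm ?invf_lt1 ?ltr1n.
rewrite telescopeK => /cvg_ex[/= l al]; apply/cvg_ex; exists (l + a 0).
move: (a 0) al => c al.
have -> : a = (fun k => (a k - c) + c) by apply/funext => k; rewrite subrK.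
by apply: cvgD => //; exact: cvg_cst.
Qed.

(** If the steps decrease geometrically in norm, the weighted sum [g] of their
squares is integrable, hence finite almost everywhere.  At a point where it is
finite the steps are dominated by a geometric sequence, so the sequence
converges there.  Fatou's lemma turns the pointwise limit into a limit in
norm. *)
Lemma L2_complete_fast (u_ : nat -> L2 Omega) :
  (forall k l, (k <= l)%N -> L2norm (u_ l - u_ k) ^+ 2 <= 8^-1 ^+ k) ->
  exists w, L2cvg u_ w.
Proof.
move=> fast.
(* With weights [4 ^ k] the integral of the k-th term is at most [2 ^ - k], and
   finiteness of [g x] still forces steps of order [2 ^ - k] at x. *)
pose g (x : 'rV[R]_n) : \bar R :=
  (\sum_(0 <= k <oo) ((4 ^+ k) * (u_ k.+1 x - u_ k x) ^+ 2)%:E)%E.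
have mu_ k : measurable_fun setT (u_ k : 'rV[R]_n -> R) by [].
have mt k : measurable_fun setT
    (fun x => ((4 ^+ k) * (u_ k.+1 x - u_ k x) ^+ 2)%:E).
  apply/measurable_EFinP/measurable_funM => //; apply/measurable_funX.
  exact: measurable_funB.
have t0 k x : (0 <= ((4 ^+ k) * (u_ k.+1 x - u_ k x) ^+ 2)%:E)%E.
  by rewrite lee_fin mulr_ge0 ?sqr_ge0 ?exprn_ge0.
have mg : measurable_fun setT g by apply: ge0_emeasurable_sum.
have intg : (\int[mu]_x g x < +oo)%E.
  rewrite integral_nneseries//.
  apply: (@le_lt_trans _ _ (\sum_(0 <= k <oo) (geometric (1:R) 2^-1 k)%:E)%E).
    apply: lee_nneseries => k _.
      by move=> _; apply: integral_ge0 => x _; exact: t0.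
    under eq_integral do rewrite EFinM.
    rewrite ge0_integralZl//; last 2 first.
      by apply/measurable_EFinP/measurable_funX/measurable_funB.
      by move=> x _; rewrite lee_fin sqr_ge0.
    rewrite -[X in (_ * X)%E]/(\int[mu]_x (((u_ k.+1 - u_ k) x) ^+ 2)%:E)%E.
    rewrite integral_sqr_L2 -EFinM lee_fin /= mul1r.
    apply: (@le_trans _ _ (4 ^+ k * 8^-1 ^+ k)).
      by rewrite ler_pM2l ?exprn_gt0// fast.
    by rewrite -exprMn (_ : 4 * 8^-1 = 2^-1 :> R)//; lra.
  apply: (@le_lt_trans _ _ 2%:E); last exact: ltry.
  apply: nneseries_EFin_le => [k|N]; first by rewrite /= mul1r exprn_ge0.
  suff -> : \sum_(0 <= k < N) geometric 1 2^-1 k = 2 - 2 * 2^-1 ^+ N :> R.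
    by rewrite gerBl mulr_ge0// exprn_ge0.
  elim: N => [|N IH]; first by rewrite big_nil expr0 mulr1 subrr.
  by rewrite big_nat_recr//= IH exprS; lra.
have g0 x : (0 <= g x)%E by apply: nneseries_ge0.
have ig : mu.-integrable setT g.
  apply/integrableP; split=> //.
  by under eq_integral do rewrite gee0_abs//.
pose A := [set x | g x \is a fin_num].
have mA : measurable A.
  rewrite -[A]setTI; apply: emeasurable_fin_num => //.
have cu x : A x -> cvgn (u_ ^~ x).
  move=> Ax; apply: (@geometric_steps_cvg _ (Num.sqrt (fine (g x)))) => k.
  have : (((4 ^+ k) * (u_ k.+1 x - u_ k x) ^+ 2)%:E <= g x)%E.
    apply: le_trans (nneseries_lim_ge k.+1 (fun j _ _ => t0 j x)).
    by rewrite big_nat_recr//= leeDr// sume_ge0.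
  rewrite -(fineK Ax) lee_fin => h; have fg0 := fine_ge0 (g0 x).
  rewrite -sqrtr_sqr -[2^-1 ^+ k]ger0_norm ?exprn_ge0// -sqrtr_sqr -sqrtrM//.
  rewrite ler_wsqrtr// -exprM mulnC exprM exprVn.
  rewrite (_ : 2 ^+ 2 = 4); last by lra.
  by rewrite exprVn ler_pdivlMr ?exprn_gt0// mulrC.
(* Multiplying by the indicator of the set of convergence makes the limit exist
   everywhere, hence measurable. *)
pose f x : R := limn (fun k => u_ k x * \1_A x).
have cf : forall y, (fun k => u_ k y * \1_A y) @ \oo --> f y.
  move=> x; suff : cvgn (fun k => u_ k x * \1_A x) by [].
  rewrite indicE; case: (boolP (x \in A)) => [/set_mem /cu h|_].
    by under eq_fun do rewrite mulr1.
  by under eq_fun do rewrite mulr0; exact: is_cvg_cst.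
have mf : measurable_fun setT f.
  apply: (@measurable_fun_cvg _ _ _ _ (fun k x => u_ k x * \1_A x)) => // k.
  by apply: measurable_funM => //; exact: measurable_indic.
have bound k : (\int[mu]_x ((f x - u_ k x) ^+ 2)%:E <= (8^-1 ^+ k)%:E)%E.
  apply: (@le_trans _ _
      (\int[mu]_x limn_einf (fun l => ((u_ l x - u_ k x) ^+ 2)%:E))%E).
    apply: ae_ge0_le_integral => //.
    - by move=> x _; rewrite lee_fin sqr_ge0.
    - by apply/measurable_EFinP/measurable_funX/measurable_funB.
    - move=> x _; apply: limn_einf_ge_near; apply: nearW => l.
      by rewrite lee_fin sqr_ge0.
    - apply: measurableT_comp => //; apply: measurable_fun_limn_esup => l.
      apply: measurableT_comp => //.
      by apply/measurable_EFinP/measurable_funX/measurable_funB.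
    - apply: filterS (integrable_ae measurableT ig) => x /(_ I) Ax _.
      have fx : u_ ^~ x @ \oo --> f x.
        have := cf x; rewrite indicE mem_set//=.
        by under eq_fun do rewrite mulr1.
      have dx : (fun l => u_ l x - u_ k x) @ \oo --> f x - u_ k x.
        by apply: cvgB => //; exact: cvg_cst.
      have dx2 : (fun l => ((u_ l x - u_ k x) ^+ 2)%:E) @ \oo -->
          ((f x - u_ k x) ^+ 2)%:E.
        by apply: cvg_EFin; [exact: nearW|exact: (cvgM dx dx)].
      by rewrite (cvg_limn_einf_sup dx2).1.
  apply: le_trans (fatou _ _ _ _) _ => //.
  - by move=> l; apply/measurable_EFinP/measurable_funX/measurable_funB.
  - by move=> l x _; rewrite lee_fin sqr_ge0.
  - apply: limn_einf_le_near; exists k => // l /= kl.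
    rewrite -[leLHS]/(\int[mu]_x (((u_ l - u_ k) x) ^+ 2)%:E)%E.
    by rewrite integral_sqr_L2 lee_fin fast.
have dP k : (fun x => f x - u_ k x) \in Lfun mu 2%:E.
  apply: integral_sqr_Lfun2; first exact: measurable_funB.
  by apply: le_lt_trans (bound k) _; rewrite ltry.
pose dk k : L2 Omega := Lfun_Sub (lee1n 2) (dP k).
exists (dk 0 + u_ 0).
apply: (@cvg0_le _ _ (fun k => Num.sqrt (8^-1) ^+ k)).
  move=> k; rewrite L2norm_ge0/=.
  have -> : u_ k - (dk 0 + u_ 0) = - dk k.
    apply/LfuneqP => x.
    change (u_ k x - ((f x - u_ 0 x) + u_ 0 x) = - (f x - u_ k x)); ring.
  rewrite L2normN -(@ler_pXn2r _ 2) ?nnegrE ?L2norm_ge0 ?exprn_ge0 ?sqrtr_ge0//.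
  by rewrite exprAC sqr_sqrtr// -lee_fin -integral_sqr_L2 bound.
apply: cvg_expr; rewrite ger0_norm ?sqrtr_ge0// -[ltRHS]sqrtr1 ltr_sqrt//; lra.
Qed.

Lemma L2_complete (u_ : nat -> L2 Omega) :
  (forall e, 0 < e -> exists N, forall k l, (N <= k)%N -> (N <= l)%N ->
    L2norm (u_ k - u_ l) <= e) ->
  exists w, L2cvg u_ w.
Proof.
move=> cau.
have e0 k : 0 < Num.sqrt (8^-1 ^+ k) :> R by rewrite sqrtr_gt0 exprn_gt0.
pose N k := sval (cid (cau _ (e0 k))).
have NP k := svalP (cid (cau _ (e0 k))).
(* The summand [k] makes [M] unbounded even if all the [N k] vanish. *)
pose M k := (k + \sum_(i < k.+1) N i)%N.
have NM k : (N k <= M k)%N by rewrite /M big_ord_recr/= addnA leq_addl.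
have MM k l : (k <= l)%N -> (M k <= M l)%N.
  move=> kl; rewrite /M leq_add// -!(big_mkord xpredT N).
  by rewrite [leqRHS](@big_cat_nat _ _ _ k.+1)//= leq_addr.
have [|w vw] := @L2_complete_fast (fun k => u_ (M k)).
  move=> k l kl; rewrite -[leRHS]sqr_sqrtr ?exprn_ge0//.
  rewrite lerXn2r ?nnegrE ?L2norm_ge0 ?sqrtr_ge0//.
  by apply: NP => //; rewrite (leq_trans (NM k))// MM.
exists w; apply/cvgr0Pnorm_le => e eps0.
have e2 : 0 < e / 2 by rewrite divr_gt0.
have [K KP] := cau _ e2.
move/cvgr0Pnorm_le/(_ _ e2) : vw => -[K' _ K'P].
exists K => // k /= Kk; rewrite ger0_norm ?L2norm_ge0//.
pose j := maxn K K'.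
have Kj : (K <= M j)%N by rewrite (leq_trans (leq_maxl K K'))// leq_addr.
rewrite (le_trans (L2norm_sub_trans (u_ (M j)) _ _))// (splitr e) lerD ?KP//.
have /= := K'P j (leq_maxr K K').
by rewrite ger0_norm ?L2norm_ge0.
Qed.

End L2_completeness.

(** * Orthogonal series *)

(** The vectors are families [e m] of [p] functions, with the inner product
summed over the components, so that the same statements serve for the
eigenfunctions ([p = 1], weights 1) and for their gradients ([p = n], weights
[lam m]). *)
Section orthogonal_series.
Context {R : realType} {n : nat} {Omega : lipschitz_domain R n}.
Variables (p : nat) (e : nat -> 'I_p -> L2 Omega) (w : R^nat).
Hypothesis e_orth :
  forall m l, \sum_i ip (e m i) (e l i) = w m * (m == l)%:R.

Lemma orth_sum_sqnorm (c : R^nat) N :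
  \sum_i L2norm (\sum_(m < N) c m *: e m i) ^+ 2 =
  \sum_(m < N) w m * c m ^+ 2.
Proof.
under eq_bigr do rewrite L2norm_sqr ip_suml.
rewrite exchange_big/=; apply: eq_bigr => m _.
transitivity (\sum_(l < N) c m * c l * \sum_i ip (e m i) (e l i)).
  under [RHS]eq_bigr do rewrite mulr_sumr.
  rewrite exchange_big/=; apply: eq_bigr => i _.
  by rewrite ip_sumr; apply: eq_bigr => l _; rewrite ipZl ipZr mulrA.
rewrite (bigD1 m)//= e_orth eqxx big1 ?addr0.
  by rewrite mulr1 expr2 mulrC.
by move=> l lm; rewrite e_orth eq_sym (inj_eq val_inj) (negPf lm) !mulr0.
Qed.

(** The squared distance of two partial sums is a section of a convergent
numerical series, so the partial sums form a Cauchy sequence. *)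
Lemma orth_series_cvg (c : R^nat) :
  (\sum_(0 <= m <oo) (w m * c m ^+ 2)%:E < +oo)%E ->
  forall i, exists g, L2cvg (fun N => \sum_(m < N) c m *: e m i) g.
Proof.
have w0 m : 0 <= w m.
  have := e_orth m m; rewrite eqxx mulr1 => <-.
  by apply: sumr_ge0 => i _; exact: ip_ge0.
move=> coo i; apply: L2_complete => eps eps0.
have a0 m : 0 <= w m * c m ^+ 2 by rewrite mulr_ge0 ?sqr_ge0.
have [l _ al] := nneseries_fin_cvg a0 coo.
have e2 : 0 < eps ^+ 2 by rewrite exprn_gt0.
have /cvgrPdist_lt/(_ _ e2) [K _ KP] := al.
have aK N : \sum_(k < N) w k * c k ^+ 2 <= l.
  exact: (partial_sum_le a0 al).
have main k N : (K <= k <= N)%N ->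
    L2norm (\sum_(m < N) c m *: e m i - \sum_(m < k) c m *: e m i) <= eps.
  case/andP => Kk kN.
  (* The difference of two partial sums is the partial sum of the sequence c
     truncated below k, to which [orth_sum_sqnorm] applies. *)
  pose c' m := c m * (k <= m)%N%:R.
  have c'0 m : (0 <= m < k)%N -> c' m = 0.
    by case/andP => _ mk; rewrite /c' leqNgt mk mulr0.
  have c'E m : (k <= m < N)%N -> c' m = c m.
    by case/andP => km _; rewrite /c' km mulr1.
  have -> : \sum_(m < N) c m *: e m i - \sum_(m < k) c m *: e m i =
      \sum_(m < N) c' m *: e m i.
    rewrite -!(big_mkord xpredT (fun m => c m *: e m i)).
    rewrite -(big_mkord xpredT (fun m => c' m *: e m i)).
    rewrite !(@big_cat_nat _ _ _ k 0 N)//= [LHS]addrC addKr.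
    rewrite [X in _ = X + _]big1_seq ?add0r; last first.
      by move=> m /andP[_]; rewrite mem_index_iota => /c'0 ->; rewrite scale0r.
    by apply: eq_big_nat => m /c'E ->.
  rewrite -(@ler_pXn2r _ 2) ?nnegrE ?L2norm_ge0 ?(ltW eps0)//.
  apply: (@le_trans _ _ (\sum_i L2norm (\sum_(m < N) c' m *: e m i) ^+ 2)).
    by rewrite [leRHS](bigD1 i)//= lerDl sumr_ge0// => j _; exact: sqr_ge0.
  rewrite orth_sum_sqnorm.
  have := KP k Kk; rewrite ger0_norm ?subr_ge0 ?aK//; have := aK N.
  rewrite -(big_mkord xpredT (fun m => w m * c' m ^+ 2)).
  rewrite -!(big_mkord xpredT (fun m => w m * c m ^+ 2)).
  rewrite !(@big_cat_nat _ _ _ k 0 N)//=.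
  rewrite [X in _ -> _ -> X + _ <= _]big1_seq; last first.
    move=> m /andP[_]; rewrite mem_index_iota => /c'0 ->.
    by rewrite expr0n mulr0.
  have -> : \sum_(k <= m < N) w m * c' m ^+ 2 =
      \sum_(k <= m < N) w m * c m ^+ 2.
    by apply: eq_big_nat => m /c'E ->.
  by move=> h1 h2; lra.
exists K => k N Kk KN; have [kN|/ltnW kN] := leqP k N.
  by rewrite L2normB main// Kk.
by rewrite main// KN.
Qed.

End orthogonal_series.

(** * Expansion of the energies in the eigenbasis *)

Section spectral_energy.
Context {R : realType} {n : nat} {Omega : lipschitz_domain R n}.
Variables (psi : nat -> L2 Omega) (lam : nat -> R).
Hypothesis hpsi : dirichlet_eigenbasis psi lam.
Implicit Types u v w : L2 Omega.

Lemma eigenvalue_gt0 m : 0 < lam m.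
Proof.
by apply: lt_le_trans (eigen_gt0 hpsi) _; apply: (eigen_nondecreasing hpsi).
Qed.

Let psi_orth m l : \sum_(i < 1) ip (psi m) (psi l) = 1 * (m == l)%:R.
Proof. by rewrite big_ord1 mul1r (eigen_orthonormal hpsi). Qed.

Lemma parseval u :
  (\sum_(0 <= m <oo) (ip u (psi m) ^+ 2)%:E = (L2norm u ^+ 2)%:E)%E.
Proof.
apply/nneseries_EFinP => [k|]; first exact: sqr_ge0.
have h := L2cvg_norm (eigen_basis hpsi u).
have -> : (fun N => \sum_(k < N) ip u (psi k) ^+ 2) =
    (fun N => L2norm (\sum_(k < N) ip u (psi k) *: psi k) *
              L2norm (\sum_(k < N) ip u (psi k) *: psi k)).
  apply/funext => N; have := orth_sum_sqnorm psi_orth (fun m => ip u (psi m)) N.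
  by rewrite big_ord1 -expr2 => ->; apply: eq_bigr => m _; rewrite mul1r.
by rewrite expr2; exact: cvgM.
Qed.

Lemma ip_sum_psi (c : R^nat) N l :
  ip (\sum_(m < N) c m *: psi m) (psi l) = c l * (l < N)%N%:R.
Proof.
rewrite ip_suml; under eq_bigr do rewrite ipZl (eigen_orthonormal hpsi).
case: ltnP => [lN|Nl]; last first.
  rewrite mulr0 big1// => m _; rewrite ltn_eqF ?mulr0//.
  exact: leq_trans Nl.
rewrite mulr1 (bigD1 (Ordinal lN))//= eqxx mulr1 big1 ?addr0// => m ml.
rewrite (_ : (m == l :> nat) = false) ?mulr0//.
by apply: contra_neqF ml => /eqP ml; apply/val_inj.
Qed.

Lemma L2cvg_coeff (c : R^nat) w :
  L2cvg (fun N => \sum_(m < N) c m *: psi m) w -> forall l, ip w (psi l) = c l.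
Proof.
move=> cw l; have /= h := L2cvg_ip (v := psi l) cw.
apply: (cvg_unique _ h) => //.
apply: cvg_near_cst; exists l.+1 => // N /= lN.
by rewrite ip_sum_psi lN mulr1.
Qed.

Lemma riesz_fischer (c : R^nat) : (\sum_(0 <= m <oo) (c m ^+ 2)%:E < +oo)%E ->
  exists w, L2cvg (fun N => \sum_(m < N) c m *: psi m) w.
Proof.
move=> coo; apply: (orth_series_cvg psi_orth _ ord0).
by under eq_eseriesr do rewrite mul1r.
Qed.

Definition spectral_energy (mu s : R) u : \bar R :=
  (mu%:E * \sum_(0 <= m <oo) (lam m `^ s * ip u (psi m) ^+ 2)%:E)%E.

(** Finiteness of the series is membership in H^s; it is also what
[riesz_fischer] needs for the series defining the fractional Laplacian to have a
sum, whose coefficients are then known. *)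
Lemma frac_energyE mu s u : 0 < mu ->
  frac_energy psi lam mu s u = spectral_energy mu s u.
Proof.
move=> mu0; rewrite /frac_energy /spectral_energy.
case: ifPn => [|] uHs; last first.
  move: uHs; rewrite notin_setE /Hs/= => /negP.
  rewrite -leNgt leye_eq => /eqP ->.
  by rewrite gt0_muley.
move: uHs; rewrite inE /Hs/= => uHs.
pose c m := lam m `^ (s / 2) * ip u (psi m).
have cE m : c m ^+ 2 = lam m `^ s * ip u (psi m) ^+ 2.
  rewrite /c exprMn; congr (_ * _).
  by rewrite -powR_mulrn ?powR_ge0// -powRrM divfK.
have coo : (\sum_(0 <= m <oo) (c m ^+ 2)%:E < +oo)%E.
  by under eq_eseriesr do rewrite cE.
have := riesz_fischer coo => /(xgetPex 0); rewrite -/(L2series _) => fw.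
rewrite EFinM -parseval; congr (_ * _)%E.
by apply: eq_eseriesr => m _; rewrite (L2cvg_coeff fw) cE.
Qed.

End spectral_energy.

(** * Mosco convergence of the spectral energies *)

Lemma cvg_powR_exponent (R : realType) (a : R) (t_ : R^nat) (t : R) :
  0 < a -> t_ @ \oo --> t -> (fun k => a `^ t_ k) @ \oo --> a `^ t.
Proof.
move=> a0 tt; rewrite /powR gt_eqF//.
apply: continuous_cvg; first exact: continuous_expR.
exact: cvgMr_tmp.
Qed.

(** Dominated convergence for series: beyond a large index the sum is at most a
tail of the series of the [a m], and below it there are finitely many terms,
each tending to 0. *)
Lemma tannery0 (R : realType) (a : R^nat) (d : nat -> nat -> R) (l : R)
    (L : R^nat) :
  (forall m, 0 <= a m) -> (forall k m, 0 <= d k m <= 1) ->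
  (forall m, d ^~ m @ \oo --> (0 : R)) ->
  (fun N => \sum_(m < N) a m) @ \oo --> l ->
  (forall k, (fun N => \sum_(m < N) d k m * a m) @ \oo --> L k) ->
  L @ \oo --> (0 : R).
Proof.
move=> a0 d01 dcvg al dL.
have da0 k m : 0 <= d k m * a m.
  by rewrite mulr_ge0//; have /andP[] := d01 k m.
have L0 k : 0 <= L k.
  rewrite -(cvg_lim _ (dL k))//; apply: limr_ge.
    by apply/cvg_ex; exists (L k).
  by apply: nearW => N; exact: sumr_ge0.
apply/cvgr0Pnorm_le => e e0.
have e2 : 0 < e / 2 by rewrite divr_gt0.
have /cvgrPdist_le/(_ _ e2) [N _ /(_ N (leqnn N)) /= NP] := al.
have : exists2 z, z = 0 & (fun k => \sum_(m < N) d k m * a m) @ \oo --> z.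
  exists (\sum_(m < N) 0 * a m); first by rewrite big1// => m _; rewrite mul0r.
  by apply: cvg_sumr => m _; exact: cvgMr_tmp.
move=> [_ -> /cvgr0Pnorm_le/(_ _ e2)]; apply: filterS => k /= kP.
rewrite ger0_norm// -(cvg_lim _ (dL k))//.
apply: limr_le; first by apply/cvg_ex; exists (L k).
exists N => // M /= NM.
have aM : \sum_(m < M) a m <= l by exact: (partial_sum_le a0 al).
move: kP NP aM; rewrite ger0_norm ?sumr_ge0//.
rewrite -!(big_mkord xpredT (fun m => d k m * a m)) -!(big_mkord xpredT a).
rewrite !(@big_cat_nat _ _ _ N 0 M)//=.
have : \sum_(N <= m < M) d k m * a m <= \sum_(N <= m < M) a m.
  apply: ler_sum => m _; rewrite ler_piMl//.
  by have /andP[] := d01 k m.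
have := ler_norm (l - \sum_(0 <= m < N) a m).
by move=> *; lra.
Qed.

Section spectral_mosco.
Context {R : realType} {n : nat} {Omega : lipschitz_domain R n}.
Variables (psi : nat -> L2 Omega) (lam : nat -> R) (mu : R).
Hypotheses (hpsi : dirichlet_eigenbasis psi lam) (mu0 : 0 < mu).
Implicit Types u v w : L2 Omega.

Local Notation E := (spectral_energy psi lam mu).

Let term_ge0 s u m : 0 <= lam m `^ s * ip u (psi m) ^+ 2.
Proof. by rewrite mulr_ge0 ?powR_ge0 ?sqr_ge0. Qed.

Lemma spectral_energy_series s u :
  E s u =
  (\sum_(0 <= m <oo) (mu * (lam m `^ s * ip u (psi m) ^+ 2))%:E)%E.
Proof.
rewrite /spectral_energy -nneseriesZl// => m _.
by rewrite lee_fin.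
Qed.

(** A partial sum involves finitely many coefficients, each of which passes to
the limit under weak convergence. *)
Lemma spectral_liminf (s_ : nat -> R) s (u_ : nat -> L2 Omega) u :
  s_ @ \oo --> s -> L2weak_cvg u_ u ->
  (E s u <= limn_einf (fun k => E (s_ k) (u_ k)))%E.
Proof.
move=> ss uu; rewrite spectral_energy_series; apply: lime_le.
  by apply: is_cvg_nneseries => m _ _; rewrite lee_fin mulr_ge0// ltW.
apply: nearW => N; rewrite sumEFin.
pose f k := \sum_(0 <= m < N) mu * (lam m `^ s_ k * ip (u_ k) (psi m) ^+ 2).
have fcvg : (fun k => (f k)%:E) @ \oo -->
    (\sum_(0 <= m < N) mu * (lam m `^ s * ip u (psi m) ^+ 2))%:E.
  apply: cvg_EFin; first exact: nearW.
  apply: cvg_sumr => m _; apply: cvgMl_tmp; apply: cvgM.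
    exact: cvg_powR_exponent (eigenvalue_gt0 hpsi m) ss.
  by rewrite expr2; apply: cvgM; exact: uu.
rewrite -(cvg_limn_einf_sup fcvg).1; apply: le_limn_einf => k.
rewrite spectral_energy_series /f -sumEFin; apply: nneseries_lim_ge => m _ _.
by rewrite lee_fin mulr_ge0// ltW.
Qed.

(** The constant sequence may fail when [s_ k > s] and [u] is not in H^(s_ k).
Lowering the m-th coefficient by a factor whose square is at most
[lam m ^ (s - s_ k)] compensates the change of exponent, and capping the factor
at 1 keeps the modified function in L^2. *)
Lemma spectral_recovery (s_ : nat -> R) s u :
  s_ @ \oo --> s -> exists u_ : nat -> L2 Omega, L2cvg u_ u /\
    forall k, (E (s_ k) (u_ k) <= E s u)%E.
Proof.
move=> ss.
pose b k m := Num.min 1 (lam m `^ ((s - s_ k) / 2)).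
have b0 k m : 0 <= b k m by rewrite le_min ler01 powR_ge0.
have b1 k m : b k m <= 1 by rewrite ge_min lexx.
have bsq k m : b k m ^+ 2 <= lam m `^ (s - s_ k).
  rewrite -[s - s_ k](@divfK _ 2)// powRrM powR_mulrn ?powR_ge0//.
  by rewrite lerXn2r ?nnegrE ?powR_ge0// ge_min lexx orbT.
have bcvg m : (fun k => 1 - b k m) @ \oo --> (0 : R).
  have lam0 := eigenvalue_gt0 hpsi m.
  have : (fun k => lam m `^ ((s - s_ k) / 2)) @ \oo --> lam m `^ ((s - s) / 2).
    apply: cvg_powR_exponent => //; apply: cvgMr_tmp; apply: cvgB => //.
    exact: cvg_cst.
  rewrite subrr mul0r powRr0 => /subr_cvg0 h.
  apply: cvg0_le (iffRL (norm_cvg0P _) h) => k.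
  rewrite subr_ge0 b1/= distrC /b minElt.
  by case: ifPn => [_|_]; [rewrite subrr|exact: ler_norm].
have /choice[u_ u_P] : forall k, exists w,
    L2cvg (fun N => \sum_(m < N) (b k m * ip u (psi m)) *: psi m) w.
  move=> k; apply: (riesz_fischer hpsi (c := fun m => b k m * ip u (psi m))).
  apply: (@le_lt_trans _ _ (\sum_(0 <= m <oo) (ip u (psi m) ^+ 2)%:E)%E).
    apply: lee_nneseries => m _; first by rewrite lee_fin sqr_ge0.
    by rewrite lee_fin exprMn ler_piMl ?sqr_ge0// exprn_ile1.
  by rewrite (parseval hpsi) ltry.
have u_E k m : ip (u_ k) (psi m) = b k m * ip u (psi m).
  exact: (L2cvg_coeff hpsi (c := fun m => b k m * ip u (psi m)) (u_P k)).
exists u_; split; last first.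
  move=> k; rewrite /spectral_energy lee_pmul2l//; last first.
  apply: lee_nneseries => m _; first by rewrite lee_fin.
  rewrite lee_fin u_E exprMn mulrA ler_wpM2r ?sqr_ge0//.
  apply: (@le_trans _ _ (lam m `^ s_ k * lam m `^ (s - s_ k))).
    by rewrite ler_wpM2l ?powR_ge0.
  rewrite -powRD; first by rewrite addrC subrK.
  by rewrite (gt_eqF (eigenvalue_gt0 hpsi m)) implybT.
have d01 k m : 0 <= (1 - b k m) ^+ 2 <= 1.
  by rewrite sqr_ge0/= exprn_ile1// ?subr_ge0// gerBl.
have dcvg m : (fun k => (1 - b k m) ^+ 2) @ \oo --> (0 : R).
  under eq_fun do rewrite expr2.
  by rewrite -(mul0r 0); exact: cvgM.
have a0 m : 0 <= ip u (psi m) ^+ 2 by exact: sqr_ge0.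
have al := (nneseries_EFinP _ a0).1 (parseval hpsi u).
have dL k : (fun N => \sum_(m < N) (1 - b k m) ^+ 2 * ip u (psi m) ^+ 2)
    @ \oo --> L2norm (u_ k - u) ^+ 2.
  have da0 m : 0 <= (1 - b k m) ^+ 2 * ip u (psi m) ^+ 2.
    by rewrite mulr_ge0 ?sqr_ge0.
  apply: (nneseries_EFinP _ da0).1.
  rewrite -(parseval hpsi); apply: eq_eseriesr => m _.
  by rewrite ipBl u_E -exprMn; congr (_%:E); ring.
have := tannery0 a0 d01 dcvg al dL => h.
have : Num.sqrt (L2norm (u_ k - u) ^+ 2) @[k --> \oo] --> Num.sqrt (0 : R).
  by apply: continuous_cvg => //; exact: sqrt_continuous.
rewrite sqrtr0; under eq_fun do rewrite sqrtr_sqr ger0_norm ?L2norm_ge0//.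
by [].
Qed.

Lemma spectral_mosco s : mosco_lim_at (frac_energy psi lam mu) s (E s).
Proof.
move=> s_ s01 ss.
have fE k u : frac_energy psi lam mu (s_ k) u = E (s_ k) u.
  exact: frac_energyE.
split=> [u_ u uu|u].
  by under eq_fun do rewrite fE; exact: spectral_liminf.
have [u_ [uu le]] := spectral_recovery u ss; exists u_; split=> //.
by apply: limn_esup_le_near; apply: nearW => k; rewrite fE.
Qed.

End spectral_mosco.

(** * Integration of partial derivatives *)

Section continuity_rV.
Context {R : realType}.

Lemma continuous_to_rV (T : topologicalType) m (F : T -> 'rV[R]_m) :
  (forall j, continuous (fun t => F t 0 j : R)) -> continuous F.
Proof.
move=> cF t A [P Pt PA].
have : \forall s \near t, forall j, P 0 j (F s 0 j).
  by apply: filter_forall => j; apply: cF; exact: Pt.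
by apply: filterS => s Ps; apply: PA => i j; rewrite ord1.
Qed.

Lemma continuous_rV_cons_tail m (t : R) :
  continuous (fun x : 'rV[R]_m => rV_cons (t, x)).
Proof.
apply: continuous_to_rV => j; have [k ->|->] := unliftP ord0 j.
  rewrite (_ : (fun _ => _) = (fun x : 'rV[R]_m => x 0 k)).
    exact: coord_continuous.
  by apply/funext => x; rewrite rV_consS.
rewrite (_ : (fun _ => _) = (fun x : 'rV[R]_m => t)).
  exact: cst_continuous.
by apply/funext => x; rewrite rV_cons0.
Qed.

Lemma continuous_rV_cons_head m (x : 'rV[R]_m) :
  continuous (fun t : R => rV_cons (t, x)).
Proof.
apply: continuous_to_rV => j; have [k ->|->] := unliftP ord0 j.
  rewrite (_ : (fun _ => _) = (fun t : R => x 0 k)).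
    exact: cst_continuous.
  by apply/funext => t; rewrite rV_consS.
rewrite (_ : (fun _ => _) = (fun t : R => t)); first by move=> ?.
by apply/funext => t; rewrite rV_cons0.
Qed.

Let rV_lin m (h : R) (w y : 'rV[R]_m) j : (h *: w + y) 0 j = h * w 0 j + y 0 j.
Proof. by rewrite !mxE. Qed.

Lemma rV_consD_tail m (t h : R) (x : 'rV[R]_m) (i : 'I_m) :
  rV_cons (t, h *: unit_vec i + x) =
  h *: unit_vec (lift ord0 i) + rV_cons (t, x).
Proof.
apply/rowP => j; rewrite rV_lin; have [k ->|->] := unliftP ord0 j.
  by rewrite !rV_consS/= rV_lin !mxE (inj_eq lift_inj).
by rewrite !rV_cons0/= mxE (negPf (neq_lift _ _)) andbF mulr0 add0r.
Qed.

Lemma rV_consD_head m (t h : R) (x : 'rV[R]_m) :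
  rV_cons (h *: (1 : R) + t, x) = h *: unit_vec ord0 + rV_cons (t, x).
Proof.
apply/rowP => j; rewrite rV_lin; have [k ->|->] := unliftP ord0 j.
  by rewrite !rV_consS/= mxE eq_sym (negPf (neq_lift _ _)) andbF mulr0 add0r.
by rewrite !rV_cons0/= mxE eqxx.
Qed.

Lemma continuous_measurable_rV m (g : 'rV[R]_m -> R) :
  continuous g -> measurable_fun setT g.
Proof.
move=> cg; apply: (measurability _ (RGenOInfty.measurableE R)).
move=> _ [_ [a ->] <-]; rewrite setTI; apply: open_measurable_rV.
by move/continuousP : cg; apply; rewrite set_itvE; exact: open_gt.
Qed.

End continuity_rV.

(** Directional derivatives only see the restriction to a line.  This moves them
between a function of n+1 variables and its slices. *)
Lemma derive_along (R : realType) (U V : normedModType R) (f : V -> R)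
    (phi : U -> V) (x v : U) (w : V) :
  (forall h, phi (h *: v + x) = h *: w + phi x) ->
  ('D_v (f \o phi) x = 'D_w f (phi x)) *
  (derivable f (phi x) w -> derivable (f \o phi) x v).
Proof.
move=> H; rewrite /derivable /derive.
suff -> : (fun h => h^-1 *: (((f \o phi) \o shift x) (h *: v) - (f \o phi) x)) =
   (fun h => h^-1 *: ((f \o shift (phi x)) (h *: w) - f (phi x))) by [].
by apply/funext => h /=; rewrite /shift/= H.
Qed.

Lemma derive_eq0_open (R : realType) (V : normedModType R) (f : V -> R)
    (A : set V) (x v : V) :
  open A -> (forall y, A y -> f y = 0) -> A x -> 'D_v f x = 0.
Proof.
move=> oA fA Ax; rewrite (@near_eq_derive _ _ _ f (cst 0)) ?derive_cst//.
by apply: filterS (open_nbhs_nbhs (conj oA Ax)) => y /fA.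
Qed.

Lemma integral_support d (T : measurableType d) (R : realType)
    (mu : {measure set T -> \bar R}) (D : set T) (f : T -> \bar R) :
  (forall x, ~ D x -> f x = 0%E) ->
  (\int[mu]_(x in D) f x = \int[mu]_x f x)%E.
Proof.
move=> f0; rewrite integral_mkcond; apply: eq_integral => x _.
by rewrite patchE; case: ifPn => // /negP xD; rewrite f0// => /mem_set.
Qed.

Section integral_partial.
Context {R : realType}.

(** Vanishing outside a box is inherited by the slices of a function, which is
what the induction on the dimension needs. *)
Definition supported m (M : R) (f : 'rV[R]_m -> R) :=
  forall (x : 'rV[R]_m) (j : 'I_m), M < `|x 0 j| -> f x = 0.

Lemma derive_supported m (M : R) (f : 'rV[R]_m -> R) v :
  supported M f -> supported M ('D_v f).
Proof.
move=> fM x j Mx.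
apply: (@derive_eq0_open _ _ _ [set y : 'rV[R]_m | M < `|y 0 j|]) => //.
  have cj : continuous (fun y : 'rV[R]_m => `|y 0 j|).
    move=> y.
    apply: (@continuous_comp _ _ _ (fun y : 'rV[R]_m => y 0 j) Num.norm).
      exact: coord_continuous.
    exact: norm_continuous.
  by move/continuousP : cj => /(_ [set z | M < z]); apply; exact: open_gt.
by move=> y /fM.
Qed.

Lemma integrable_supported m (M : R) (g : 'rV[R]_m -> R) :
  continuous g -> supported M g ->
  (lebesgue_rV R m).-integrable setT (EFin \o g).
Proof.
move=> cg gM.
pose B := [set x : 'rV[R]_m | forall j, `[- M, M]%classic (x 0 j)].
have BE x : ~ B x -> g x = 0.
  move=> nB; apply/eqP/negPn/negP => /eqP gx; apply: nB => j /=.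
  by rewrite in_itv/= -ler_norml leNgt; apply/negP => /gM.
have cB : compact B.
  apply: (@rV_compact R m (fun=> `[- M, M]%classic)) => j.
  exact: segment_compact.
have [C [_ /(_ (C + 1)) CP]] : bounded_set (g @` B).
  apply/compact_bounded/continuous_compact => //.
  exact: continuous_subspaceT.
have gB x : B x -> `|g x| <= C + 1.
  by move=> Bx; apply: CP; [rewrite ltrDl|exists x].
have mB : measurable B.
  have -> : B = \big[setI/setT]_(j < m)
      [set x : 'rV[R]_m | `[- M, M]%classic (x 0 j)].
    rewrite -bigcap_seq; apply/seteqP; split=> [x Bx i _|x Bx i].
      exact: Bx.
    by apply: Bx; rewrite /= mem_index_enum.
  apply: bigsetI_measurable => j _; rewrite -[X in measurable X]setTI.
  by apply: (measurable_coord j measurableT (Y := `[- M, M]%classic)).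
have Bfin : (lebesgue_rV R m B < +oo)%E.
  rewrite (lebesgue_rV_box (A := fun=> `[- M, M]%classic)); last first.
    by move=> j; exact: measurable_itv.
  have [l ->] : exists l, lebesgue_measure (`[- M, M]%classic : set R) = l%:E.
    rewrite lebesgue_measure_itv/=; case: ifPn => _; last by exists 0.
    by rewrite -EFinD; eexists.
  by rewrite prodEFin ltry.
apply/integrableP; split.
  by apply/measurable_EFinP; exact: continuous_measurable_rV.
apply: (@le_lt_trans _ _ (\int[lebesgue_rV R m]_x (`|C + 1| * \1_B x)%:E)%E).
  apply: ge0_le_integral => //=.
  - apply/measurable_EFinP; apply: measurableT_comp => //.
    exact: continuous_measurable_rV.
  - by apply/measurable_EFinP/measurable_funM => //; exact: measurable_indic.
  - move=> x _; rewrite lee_fin indicE.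
    case: (boolP (x \in B)) => [/set_mem|/negP] xB.
      by rewrite mulr1 (le_trans (gB _ xB))// ler_norm.
    by rewrite BE ?normr0 ?mulr0// => /mem_set.
under eq_integral do rewrite EFinM.
rewrite ge0_integralZl//; last first.
  by apply/measurable_EFinP; exact: measurable_indic.
by rewrite integral_indic// setIT lte_mul_pinfty.
Qed.

Lemma integral_lebesgue_rVS m (M : R) (g : 'rV[R]_m.+1 -> R) :
  continuous g -> supported M g ->
  (\int[lebesgue_rV R m.+1]_x (g x)%:E =
   \int[lebesgue_measure]_t \int[lebesgue_rV R m]_x (g (rV_cons (t, x)))%:E)%E
  /\
  (\int[lebesgue_rV R m.+1]_x (g x)%:E =
   \int[lebesgue_rV R m]_x \int[lebesgue_measure]_t (g (rV_cons (t, x)))%:E)%E.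
Proof.
move=> cg gM.
have ig := integrable_supported cg gM.
have mg : measurable_fun setT (EFin \o g).
  by apply/measurable_EFinP; exact: continuous_measurable_rV.
pose P := (@lebesgue_measure R \x lebesgue_rV R m)%E.
have mcons := @measurable_rV_cons R m.
have iP : P.-integrable setT ((EFin \o g) \o @rV_cons R m).
  apply/integrableP; split; first exact: measurableT_comp.
  have -> : (fun z => `|((EFin \o g) \o @rV_cons R m) z|)%E =
      (abse \o (EFin \o g)) \o @rV_cons R m by [].
  have mag : measurable_fun setT (abse \o (EFin \o g)).
    exact: measurableT_comp.
  have := ge0_integral_pushforward mcons P measurableT mag
    (fun _ _ => abse_ge0 _).
  rewrite preimage_setT => <-.
  by have /integrableP[_] := ig.
have -> : (\int[lebesgue_rV R m.+1]_x (g x)%:E =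
    \int[P]_z ((EFin \o g) \o @rV_cons R m) z)%E.
  have := @integral_pushforward _ _ _ _ _ _ mcons P setT _ mg.
  by rewrite preimage_setT => <-.
split; first by rewrite -integral12_prod_meas1.
by rewrite -integral21_prod_meas1.
Qed.

Lemma integral_derive1_supported (M : R) (G : R -> R) :
  (forall t, derivable G t 1) -> continuous ('D_1 G) ->
  (forall t, M < `|t| -> G t = 0) ->
  (\int[lebesgue_measure]_t ('D_1 G t)%:E = 0)%E.
Proof.
move=> dG cdG GM.
have cG : continuous G.
  by move=> t; apply: differentiable_continuous; exact/derivable1_diffP.
pose K := `|M| + 1.
have K0 : 0 < K by rewrite ltr_wpDl.
have MK : M < K by rewrite (le_lt_trans (ler_norm M))// ltrDl.
have dG0 t : M < `|t| -> 'D_1 G t = 0.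
  apply: (@derive_eq0_open _ _ _ [set y : R | M < `|y|]) => //.
  have /continuousP/(_ [set z | M < z]) : continuous (fun y : R => `|y|).
    by move=> y; exact: norm_continuous.
  by apply; exact: open_gt.
transitivity (\int[lebesgue_measure]_(t in `[(- K)%R, K]) ('D_1 G t)%:E)%E.
  apply/esym/integral_support => t /= /negP.
  rewrite in_itv/= -ler_norml -ltNge => Kt.
  by rewrite dG0// (lt_trans MK).
rewrite (@continuous_FTC2 _ _ G).
- by rewrite !GM ?normrN ?gtr0_norm// subee.
- by rewrite gtrN.
- exact: continuous_subspaceT.
- split=> [t _||]; first exact: dG.
    by apply: cvg_at_right_filter; exact: cG.
  by apply: cvg_at_left_filter; exact: cG.
- by move=> t _; rewrite derive1E.
Qed.

(** Split off the first coordinate.  If it is the variable of differentiation,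
integrating in it first gives 0 by the fundamental theorem of calculus;
otherwise the integral over each slice is 0 by induction on the dimension. *)
Lemma integral_partial_supported m (i : 'I_m) (M : R) (f : 'rV[R]_m -> R) :
  (forall x, derivable f x (unit_vec i)) -> continuous ('D_(unit_vec i) f) ->
  supported M f ->
  (\int[lebesgue_rV R m]_x ('D_(unit_vec i) f x)%:E = 0)%E.
Proof.
elim: m i f => [[]//|m IH] i f df cdf fM.
have [EL ER] := integral_lebesgue_rVS cdf (derive_supported (unit_vec i) fM).
have [k ik|i0] := unliftP ord0 i; subst i.
  rewrite EL integral0_eq// => t _.
  have dd x := derive_along f (rV_consD_tail t ^~ x ^~ k).
  under eq_integral do rewrite -(dd _).1.
  apply: IH.
  - by move=> x; apply: (dd x).2.
  - rewrite (_ : 'D__ _ =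
        'D_(unit_vec (lift ord0 k)) f \o (fun x => rV_cons (t, x))).
      move=> x; apply: continuous_comp; last exact: cdf.
      exact: continuous_rV_cons_tail.
    by apply/funext => x; rewrite (dd x).1.
  - by move=> x j Mx; apply: (fM _ (lift ord0 j)); rewrite rV_consS.
rewrite ER integral0_eq// => x _.
have dd (t : R) := @derive_along R R _ f (fun t : R => rV_cons (t, x)) t 1 _
  (fun h => rV_consD_head t h x).
under eq_integral do rewrite -(dd _).1.
apply: (@integral_derive1_supported M).
- by move=> t; apply: (dd t).2.
- rewrite (_ : 'D__ _ = 'D_(unit_vec ord0) f \o (fun t : R => rV_cons (t, x))).
    move=> t; apply: continuous_comp; last exact: cdf.
    exact: continuous_rV_cons_head.
  by apply/funext => t; rewrite (dd t).1.
- by move=> t Mt; apply: (fM _ ord0); rewrite rV_cons0.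
Qed.

End integral_partial.

(** * Test functions *)

Section test_functions.
Context {R : realType} {n : nat} (Omega : lipschitz_domain R n).
Implicit Types f g : 'rV[R]_n -> R.

Local Notation test := (test_function (Omega := Omega)).

Lemma test_continuous f : test f -> continuous f.
Proof. by case=> /(_ [::])[]. Qed.

Lemma test_derivable f i x : test f -> derivable f x (unit_vec i).
Proof. by case=> /(_ [::])[_]. Qed.

Lemma test_partial_continuous f i : test f -> continuous ('D_(unit_vec i) f).
Proof. by case=> /(_ [:: i])[]. Qed.

Lemma test_supported f : test f -> exists M, supported M f.
Proof.
case=> _ /compact_bounded[M [_ MP]] _; exists (M + 2) => x j xj.
apply/eqP/negPn/negP => fx0.
have : `|x| <= M + 1 by apply: MP; [rewrite ltrDl|exact: subset_closure].
move=> xM; have : ball (0 : 'rV[R]_n) (M + 2) x.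
  rewrite mx_norm_ball /ball_/= sub0r normrN (le_lt_trans xM)//.
  by rewrite ltrD2l ltr1n.
move=> [_ /(_ 0 j)]; rewrite /ball/= mxE sub0r normrN => xjM.
by have := lt_trans xj xjM; rewrite ltxx.
Qed.

Lemma test_eq0 f x : test f -> ~ domain_set Omega x -> f x = 0.
Proof.
case=> _ _ fO nOx; apply/eqP/negPn/negP => fx0; apply: nOx.
exact/fO/subset_closure.
Qed.

Lemma test_partial_eq0 f i x :
  test f -> ~ domain_set Omega x -> 'D_(unit_vec i) f x = 0.
Proof.
case=> _ _ fO nOx.
apply: (@derive_eq0_open _ _ _ (~` closure [set y | f y != 0])).
- exact/closed_openC/closed_closure.
- move=> y yc; apply/eqP/negPn/negP => fy; apply: yc.
  exact: subset_closure.
- by move=> /fO.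
Qed.

Lemma integral_lebesgue_on f : (forall x, ~ domain_set Omega x -> f x = 0) ->
  (\int[lebesgue_on Omega]_x (f x)%:E = \int[lebesgue_rV R n]_x (f x)%:E)%E.
Proof.
move=> f0.
have fE0 x : ~ domain_set Omega x -> (f x)%:E = 0%E by move=> /f0 ->.
rewrite -(integral_support _ fE0) -[RHS](integral_support _ fE0).
apply: eq_measure_integral => A mA AO.
by rewrite -[LHS]/(lebesgue_rV R n (A `&` Omega)) setIidl.
Qed.

Lemma supported_L2 M f : continuous f -> supported M f ->
  (forall x, ~ domain_set Omega x -> f x = 0) ->
  f \in Lfun (lebesgue_on Omega) 2%:E.
Proof.
move=> cf fM f0; apply: integral_sqr_Lfun2.
  exact: continuous_measurable_rV.
rewrite (@integral_lebesgue_on (fun x => f x ^+ 2)); last first.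
  by move=> x /f0 ->; rewrite expr0n.
have cf2 : continuous (fun x => f x ^+ 2).
  by move=> x; apply: continuousM; exact: cf.
have f2M : supported M (fun x => f x ^+ 2).
  by move=> x j /fM ->; rewrite expr0n.
have /integrableP[_] := integrable_supported cf2 f2M.
by under eq_integral do rewrite /= ger0_norm ?sqr_ge0//.
Qed.

Lemma test_L2 f : test f -> f \in Lfun (lebesgue_on Omega) 2%:E.
Proof.
move=> tf; have [M fM] := test_supported tf.
apply: supported_L2 fM _; first exact: test_continuous.
by move=> x; exact: test_eq0.
Qed.

Lemma test_partial_L2 f i : test f ->
  'D_(unit_vec i) f \in Lfun (lebesgue_on Omega) 2%:E.
Proof.
move=> tf; have [M fM] := test_supported tf.
apply: supported_L2 (derive_supported (unit_vec i) fM) _.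
  exact: test_partial_continuous.
by move=> x; exact: test_partial_eq0.
Qed.

Definition toL2 f (fP : f \in Lfun (lebesgue_on Omega) 2%:E) : L2 Omega :=
  Lfun_Sub (lee1n 2) fP.

(** The difference of the two sides is the integral of a partial derivative of the
product [f * g]. *)
Lemma test_ibp f g i (tf : test f) (tg : test g) :
  ip (toL2 (test_L2 tf)) (toL2 (test_partial_L2 i tg)) =
  - ip (toL2 (test_partial_L2 i tf)) (toL2 (test_L2 tg)).
Proof.
apply/eqP; rewrite -addr_eq0 /ip -RintegralD//; try exact: integrable_mulL2.
have [M fM] := test_supported tf.
pose h x := f x * 'D_(unit_vec i) g x + 'D_(unit_vec i) f x * g x.
have DE x : 'D_(unit_vec i) (f * g) x = h x.
  rewrite deriveM; [|exact: test_derivable|exact: test_derivable].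
  by congr (_ + _); rewrite mulrC.
have fgM : supported M (f * g).
  by move=> x j /fM fx0; rewrite -[(f * g) x]/(f x * g x) fx0 mul0r.
have cD : continuous ('D_(unit_vec i) (f * g)).
  rewrite (_ : 'D__ _ = h); last exact/funext.
  have cf := test_continuous tf; have cg := test_continuous tg.
  have cdf := @test_partial_continuous f i tf.
  have cdg := @test_partial_continuous g i tg.
  by move=> x; exact: cvgD (cvgM (cf x) (cdg x)) (cvgM (cdf x) (cg x)).
have intD : (\int[lebesgue_rV R n]_x ('D_(unit_vec i) (f * g) x)%:E = 0)%E.
  apply: (integral_partial_supported _ cD fgM) => x.
  by apply: derivableM; [exact: test_derivable tf|exact: test_derivable tg].
rewrite /Rintegral (@integral_lebesgue_on h).
  by under eq_integral do rewrite -DE; rewrite intD.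
by move=> x nOx; rewrite /h (test_eq0 tf)// (test_eq0 tg)// mul0r mulr0 addr0.
Qed.

Lemma test_comb (a b : R) f g : test f -> test g ->
  test (fun x => a * f x + b * g x).
Proof.
move=> [sf cf fO] [sg cg gO].
pose D := foldr (fun i f => 'D_(unit_vec i : 'rV[R]_n) f).
have foldE s : D (fun x => a * f x + b * g x) s =
    fun x => a * D f s x + b * D g s x.
  elim: s => // i s /= ->; apply/funext => x.
  have [_ df] := sf s; have [_ dg] := sg s.
  transitivity ('D_(unit_vec i) (a \*: D f s + b \*: D g s) x); first by [].
  by rewrite deriveD ?deriveZ//; exact: derivableZ.
have sub : closure [set x | a * f x + b * g x != 0] `<=`
    closure [set x | f x != 0] `|` closure [set x | g x != 0].
  rewrite -closureU; apply: closure_subset => x /=; apply: contraNP.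
  move=> /not_orP[/negP/negPn/eqP -> /negP/negPn/eqP ->].
  by rewrite !mulr0 addr0.
split.
- move=> s; rewrite -/D [D _ s]foldE.
  have [cfs df] := sf s; have [cgs dg] := sg s; split.
    by move=> x; exact: cvgD (cvgMl_tmp (cfs x)) (cvgMl_tmp (cgs x)).
  by move=> i x; apply: derivableD; exact: derivableZ.
- apply: subclosed_compact (compactU cf cg) sub; exact: closed_closure.
- by move=> x /sub[/fO|/gO].
Qed.

Lemma test0 : test (fun=> 0).
Proof.
have f0 s : foldr (fun i f => 'D_(unit_vec i) f) (fun=> 0 : R) s = cst 0.
  elim: s => // i s /= ->; apply/funext => x; exact: derive_cst.
have E0 : [set x : 'rV[R]_n | (0 : R) != 0] = set0.
  by apply/seteqP; split => x //=; rewrite eqxx.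
split.
- move=> s; cbv zeta; rewrite f0; split; first exact: cst_continuous.
  by move=> i x; exact: derivable_cst.
- by rewrite E0 closure0; exact: compact0.
- by rewrite E0 closure0.
Qed.

End test_functions.

(** * Weak derivatives, H^1 and H^1_0 *)

Section weak_derivatives.
Context {R : realType} {n : nat} {Omega : lipschitz_domain R n}.
Implicit Types (u v w g h : L2 Omega) (i : 'I_n).

(** Both sides of the definition are inner products in L^2.  Linearity and
closedness under L^2 limits are then those of the inner product. *)
Lemma is_weak_partialP i u g : is_weak_partial i u g <->
  forall phi (tphi : test_function (Omega := Omega) phi),
    ip u (toL2 (test_partial_L2 i tphi)) = - ip g (toL2 (test_L2 tphi)).
Proof. by []. Qed.

Lemma weak_partial_comb i (a : R) u v g h :
  is_weak_partial i u g -> is_weak_partial i v h ->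
  is_weak_partial i (a *: u + v) (a *: g + h).
Proof.
move=> /is_weak_partialP ug /is_weak_partialP vh.
apply/is_weak_partialP => phi tphi.
by rewrite !ipDl !ipZl ug vh mulrN opprD.
Qed.

Lemma weak_partial0 i : is_weak_partial i (0 : L2 Omega) 0.
Proof. by apply/is_weak_partialP => phi tphi; rewrite !ip0l oppr0. Qed.

Lemma weak_partialB i u v g h :
  is_weak_partial i u g -> is_weak_partial i v h ->
  is_weak_partial i (u - v) (g - h).
Proof.
move=> ug vh; have := weak_partial_comb (-1) vh ug.
by rewrite !scaleN1r !(addrC (- _)).
Qed.

Lemma weak_partialD i u v g h :
  is_weak_partial i u g -> is_weak_partial i v h ->
  is_weak_partial i (u + v) (g + h).
Proof.
by move=> ug vh; have := weak_partial_comb 1 ug vh; rewrite !scale1r.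
Qed.

Lemma weak_partialZ i a u g :
  is_weak_partial i u g -> is_weak_partial i (a *: u) (a *: g).
Proof.
by move=> ug; have := weak_partial_comb a ug (weak_partial0 i); rewrite !addr0.
Qed.

Lemma weak_partial_sum i N (c : R^nat) (u_ g_ : nat -> L2 Omega) :
  (forall m, is_weak_partial i (u_ m) (g_ m)) ->
  is_weak_partial i (\sum_(m < N) c m *: u_ m) (\sum_(m < N) c m *: g_ m).
Proof.
move=> ug; elim: N => [|N IH]; first by rewrite !big_ord0; exact: weak_partial0.
by rewrite !big_ord_recr/=; apply: weak_partialD IH _; exact: weak_partialZ.
Qed.

Lemma weak_partial_closed i (u_ g_ : nat -> L2 Omega) u g :
  L2cvg u_ u -> L2cvg g_ g -> (forall k, is_weak_partial i (u_ k) (g_ k)) ->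
  is_weak_partial i u g.
Proof.
move=> uu gg ug; apply/is_weak_partialP => phi tphi.
have h1 := L2cvg_ip (v := toL2 (test_partial_L2 i tphi)) uu.
have h2 := cvgN (L2cvg_ip (v := toL2 (test_L2 tphi)) gg).
have E k : ip (u_ k) (toL2 (test_partial_L2 i tphi)) =
    - ip (g_ k) (toL2 (test_L2 tphi)) by exact: ug.
have h3 : (fun k => ip (u_ k) (toL2 (test_partial_L2 i tphi))) @ \oo -->
    - ip g (toL2 (test_L2 tphi)).
  under eq_fun do rewrite E.
  exact: h2.
exact: (cvg_unique _ h1 h3).
Qed.

Lemma test_weak_partial i phi (tphi : test_function (Omega := Omega) phi) :
  is_weak_partial i (toL2 (test_L2 tphi)) (toL2 (test_partial_L2 i tphi)).
Proof. by apply/is_weak_partialP => f tf; exact: test_ibp. Qed.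

Lemma weak_partialP i u : H1 u -> is_weak_partial i u (weak_partial i u).
Proof. by move=> /(_ i); exact: xgetPex. Qed.

Lemma grad_sqnorm_ge0 u : 0 <= grad_sqnorm u.
Proof. by apply: sumr_ge0 => i _; exact: sqr_ge0. Qed.

(** Sums of squares are easier to estimate than their square root.  The price is
a factor 2 in the triangle inequality [H1sqnormD_le]. *)
Definition H1sqnorm u := L2norm u ^+ 2 + grad_sqnorm u.

Lemma H1sqnorm_ge0 u : 0 <= H1sqnorm u.
Proof. by rewrite addr_ge0 ?sqr_ge0 ?grad_sqnorm_ge0. Qed.

Lemma L2norm_le_H1norm u : L2norm u <= H1norm u.
Proof.
rewrite -[leLHS]ger0_norm ?L2norm_ge0// -sqrtr_sqr ler_wsqrtr//.
by rewrite lerDl grad_sqnorm_ge0.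
Qed.

Variables (psi : nat -> L2 Omega) (lam : nat -> R).
Hypothesis hpsi : dirichlet_eigenbasis psi lam.

(** The eigenfunctions are L^2 limits of test functions, since they are in
H^1_0.  So a function orthogonal to the test functions is orthogonal to the
whole basis. *)
Lemma test_functions_total g :
  (forall phi (tphi : test_function (Omega := Omega) phi),
    ip g (toL2 (test_L2 tphi)) = 0) ->
  L2norm g = 0.
Proof.
move=> g0; apply/eqP; rewrite -sqrf_eq0 -eqe -(parseval hpsi).
rewrite eseries0// => m _ _; have [_ [phi_ [tphi cphi]]] := eigen_H10 hpsi m.
have : L2cvg phi_ (psi m).
  apply: cvg0_le cphi => k; rewrite L2norm_ge0/=; exact: L2norm_le_H1norm.
move=> /(L2cvg_ip (v := g)) h.
have : (fun k => ip (phi_ k) g) @ \oo --> (0 : R).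
  rewrite (_ : (fun k => _) = cst 0); first exact: cvg_cst.
  apply/funext => k; rewrite ipC -(g0 _ (tphi k)); congr ip; exact/LfuneqP.
move=> /(cvg_unique _ h) h0; rewrite ipC h0 ?expr0n//.
Qed.

Lemma weak_partial_unique i u g h :
  is_weak_partial i u g -> is_weak_partial i u h -> L2norm (g - h) = 0.
Proof.
move=> /is_weak_partialP ug /is_weak_partialP uh.
apply: test_functions_total => phi tphi.
by rewrite ipBl -[ip g _]opprK -ug uh opprK subrr.
Qed.

(** [grad_ip] is defined through chosen representatives of the weak gradients;
by uniqueness any others will do.  This is what makes it bilinear on H^1. *)
Lemma grad_ipE u v (g h : 'I_n -> L2 Omega) :
  (forall i, is_weak_partial i u (g i)) ->
  (forall i, is_weak_partial i v (h i)) ->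
  grad_ip u v = \sum_i ip (g i) (h i).
Proof.
move=> ug vh; apply: eq_bigr => i _.
have ug' := weak_partialP i (fun j => ex_intro _ _ (ug j)).
have vh' := weak_partialP i (fun j => ex_intro _ _ (vh j)).
rewrite (ip_null _ (weak_partial_unique ug' (ug i))) ipC.
by rewrite (ip_null _ (weak_partial_unique vh' (vh i))) ipC.
Qed.

Lemma grad_sqnormE u (g : 'I_n -> L2 Omega) :
  (forall i, is_weak_partial i u (g i)) ->
  grad_sqnorm u = \sum_i L2norm (g i) ^+ 2.
Proof.
move=> ug; have := grad_ipE ug ug; rewrite /grad_ip /grad_sqnorm.
under eq_bigr do rewrite -L2norm_sqr.
by under [RHS]eq_bigr do rewrite -L2norm_sqr.
Qed.

Lemma L2norm_sqrD_le u v :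
  L2norm (u + v) ^+ 2 <= 2 * (L2norm u ^+ 2 + L2norm v ^+ 2).
Proof.
apply: (@le_trans _ _ ((L2norm u + L2norm v) ^+ 2)).
  by rewrite lerXn2r ?nnegrE ?addr_ge0 ?L2norm_ge0// L2normD.
by have := sqr_ge0 (L2norm u - L2norm v); nra.
Qed.

Lemma H1sqnormD_le u v : H1 u -> H1 v ->
  H1sqnorm (u + v) <= 2 * (H1sqnorm u + H1sqnorm v).
Proof.
move=> Hu Hv; have uP i := weak_partialP i Hu; have vP i := weak_partialP i Hv.
rewrite /H1sqnorm (grad_sqnormE (fun i => weak_partialD (uP i) (vP i))).
rewrite addrACA mulrDr lerD ?L2norm_sqrD_le//.
rewrite /grad_sqnorm -big_split/= mulr_sumr ler_sum// => i _.
exact: L2norm_sqrD_le.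
Qed.

Lemma H1sqnormZ a u : H1 u -> H1sqnorm (a *: u) = a ^+ 2 * H1sqnorm u.
Proof.
move=> Hu; have uP i := weak_partialP i Hu.
rewrite /H1sqnorm (grad_sqnormE (fun i => weak_partialZ a (uP i))).
rewrite mulrDr mulr_sumr L2normZ exprMn real_normK ?num_real//.
congr (_ + _); apply: eq_bigr => i _.
by rewrite L2normZ exprMn real_normK ?num_real.
Qed.

Lemma H1D u v : H1 u -> H1 v -> H1 (u + v).
Proof.
move=> Hu Hv i; exists (weak_partial i u + weak_partial i v).
by apply: weak_partialD; exact: weak_partialP.
Qed.

Lemma H1Z a u : H1 u -> H1 (a *: u).
Proof.
move=> Hu i; exists (a *: weak_partial i u).
by apply: weak_partialZ; exact: weak_partialP.
Qed.

Lemma H1B u v : H1 u -> H1 v -> H1 (u - v).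
Proof. by move=> Hu Hv; rewrite -scaleN1r; apply: H1D => //; exact: H1Z. Qed.

Lemma test_H1 u : test_function (Omega := Omega) u -> H1 u.
Proof.
move=> tu i; exists (toL2 (test_partial_L2 i tu)).
by have := test_weak_partial i tu; congr is_weak_partial; exact/LfuneqP.
Qed.

Lemma H10P u : H10 u <-> H1 u /\ forall e, 0 < e ->
  exists phi : L2 Omega,
    test_function (Omega := Omega) phi /\ H1sqnorm (phi - u) < e.
Proof.
split=> [[Hu [phi_ [tphi cphi]]]|[Hu uP]]; split=> //.
  move=> e e0; have se0 : 0 < Num.sqrt e by rewrite sqrtr_gt0.
  have /cvgr0Pnorm_lt/(_ _ se0)[k _ /(_ k (leqnn k)) /=] := cphi.
  rewrite ger0_norm ?sqrtr_ge0// ltr_sqrt// => h.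
  by exists (phi_ k).
have e0 k : 0 < k.+1%:R^-1 ^+ 2 :> R by rewrite exprn_gt0// invr_gt0.
pose phi_ k := sval (cid (uP _ (e0 k))).
have phiP k := svalP (cid (uP _ (e0 k))).
exists phi_; split=> [k|]; first by case: (phiP k).
apply: (@cvg0_le _ _ (fun k => k.+1%:R^-1)); last exact: cvg_harmonic.
move=> k; rewrite sqrtr_ge0/=; have [_ /ltW h] := phiP k.
rewrite -[leRHS]ger0_norm ?invr_ge0// -[leRHS]sqrtr_sqr.
exact: ler_wsqrtr.
Qed.

Lemma H10_closed u : H1 u ->
  (forall e, 0 < e -> exists v, H10 v /\ H1sqnorm (v - u) < e) -> H10 u.
Proof.
move=> Hu uP; apply/H10P; split=> // e e0.
have e4 : 0 < e / 4 by rewrite divr_gt0.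
have [v [/H10P[Hv vP] vu]] := uP _ e4.
have [phi [tphi phiv]] := vP _ e4; exists phi; split=> //.
rewrite -(subrKA v); apply: le_lt_trans (H1sqnormD_le _ _) _.
- by apply: H1B => //; exact: test_H1.
- exact: H1B.
- by lra.
Qed.

Lemma H10_comb (a b : R) u v : H10 u -> H10 v -> H10 (a *: u + b *: v).
Proof.
move=> /H10P[Hu uP] /H10P[Hv vP]; apply/H10P; split.
  by apply: H1D; exact: H1Z.
move=> e e0.
(* The bound to reach is [2 * (a ^+ 2 + b ^+ 2) * c < e]. *)
have c0 : 0 < e / (4 * (a ^+ 2 + b ^+ 2 + 1)).
  by rewrite divr_gt0// mulr_gt0// ltr_wpDl// addr_ge0 ?sqr_ge0.
have [f [tf fu]] := uP _ c0; have [g [tg gv]] := vP _ c0.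
exists (a *: f + b *: g); split; first exact: test_comb.
rewrite opprD addrACA -!scalerBr.
have Hfu : H1 (f - u) by apply: H1B => //; exact: test_H1.
have Hgv : H1 (g - v) by apply: H1B => //; exact: test_H1.
apply: le_lt_trans (H1sqnormD_le (H1Z _ Hfu) (H1Z _ Hgv)) _.
rewrite !H1sqnormZ//.
move: fu gv; rewrite !ltr_pdivlMr; last 2 first.
  by rewrite mulr_gt0// ltr_wpDl// addr_ge0 ?sqr_ge0.
  by rewrite mulr_gt0// ltr_wpDl// addr_ge0 ?sqr_ge0.
have := H1sqnorm_ge0 (f - u); have := H1sqnorm_ge0 (g - v).
have := sqr_ge0 a; have := sqr_ge0 b.
move: (a ^+ 2) (b ^+ 2) (H1sqnorm _) (H1sqnorm _) => A B P Q.
by move=> *; nra.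
Qed.

Lemma H10_0 : H10 (0 : L2 Omega).
Proof.
apply/H10P; split=> [i|e e0]; first by exists 0; exact: weak_partial0.
exists 0; split; first exact: test0.
rewrite subr0 /H1sqnorm (grad_sqnormE (fun i => weak_partial0 i)).
by rewrite L2norm_sqr ip0l add0r big1// => i _; rewrite L2norm_sqr ip0l.
Qed.

Lemma H10_sum N (c : R^nat) (u_ : nat -> L2 Omega) :
  (forall m, H10 (u_ m)) -> H10 (\sum_(m < N) c m *: u_ m).
Proof.
move=> Hu; elim: N => [|N IH]; first by rewrite big_ord0; exact: H10_0.
by have := H10_comb 1 (c N) IH (Hu N); rewrite scale1r big_ord_recr.
Qed.

End weak_derivatives.

(** * The Dirichlet energy *)

Section dirichlet_energy.
Context {R : realType} {n : nat} {Omega : lipschitz_domain R n}.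
Variables (psi : nat -> L2 Omega) (lam : nat -> R).
Hypothesis hpsi : dirichlet_eigenbasis psi lam.
Implicit Types u v w g : L2 Omega.

Let G m i := weak_partial i (psi m).

Let GP m i : is_weak_partial i (psi m) (G m i).
Proof. by apply: weak_partialP; have [] := eigen_H10 hpsi m. Qed.

(** The weak eigenvalue equation of [psi m], tested with [psi l]. *)
Let G_orth m l : \sum_i ip (G m i) (G l i) = lam m * (m == l)%:R.
Proof.
rewrite -(eigen_orthonormal hpsi) -(eigen_eq hpsi)//; exact: eigen_H10 hpsi l.
Qed.

Let term_ge0 u m : 0 <= lam m * ip u (psi m) ^+ 2.
Proof. by rewrite mulr_ge0 ?sqr_ge0// ltW// (eigenvalue_gt0 hpsi). Qed.

(** By the weak eigenvalue equation tested with [u], the coefficient of the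
gradient of [u] along that of [psi m] is the one of [u] along [psi m].  So this
is Bessel's inequality for the orthogonal family of the gradients. *)
Lemma dirichlet_bessel u N : H10 u ->
  \sum_(m < N) lam m * ip u (psi m) ^+ 2 <= grad_sqnorm u.
Proof.
move=> Hu; have uP i := weak_partialP i Hu.1.
pose S i := \sum_(m < N) ip u (psi m) *: G m i.
have SS := orth_sum_sqnorm G_orth (fun m => ip u (psi m)) N.
have gS : \sum_i ip (weak_partial i u) (S i) =
    \sum_(m < N) lam m * ip u (psi m) ^+ 2.
  under eq_bigr do rewrite ip_sumr.
  rewrite exchange_big/=; apply: eq_bigr => m _.
  under eq_bigr do rewrite ipZr (ipC (weak_partial _ u)).
  have gu : \sum_i ip (G m i) (weak_partial i u) = lam m * ip u (psi m).
    by rewrite ipC -(eigen_eq hpsi).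
  by rewrite -mulr_sumr gu mulrCA -expr2.
have : 0 <= \sum_i L2norm (weak_partial i u - S i) ^+ 2.
  by apply: sumr_ge0 => i _; exact: sqr_ge0.
under eq_bigr do rewrite L2norm_sqr !(ipBl, ipBr) -!L2norm_sqr (ipC (S _)).
by rewrite !sumrB gS SS subrr subr0 subr_ge0.
Qed.

(** The partial sums of the expansion of [u] are in H^1_0 and converge to [u] in
L^2, and their gradients converge by [orth_series_cvg].  The limit of the
gradients is the weak gradient of [u], so the convergence takes place in H^1. *)
Lemma finite_energy_H10 u :
  (\sum_(0 <= m <oo) (lam m * ip u (psi m) ^+ 2)%:E < +oo)%E ->
  H10 u /\
  (\sum_(0 <= m <oo) (lam m * ip u (psi m) ^+ 2)%:E = (grad_sqnorm u)%:E)%E.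
Proof.
move=> foo; pose c m := ip u (psi m).
pose S N := \sum_(m < N) c m *: psi m.
pose SG N i := \sum_(m < N) c m *: G m i.
have /choice[g gP] : forall i, exists g, L2cvg (SG ^~ i) g.
  by move=> i; apply: (orth_series_cvg G_orth (c := c)).
have Su : L2cvg S u := eigen_basis hpsi u.
have SP N i : is_weak_partial i (S N) (SG N i).
  exact: (weak_partial_sum N c (g_ := G ^~ i) (GP ^~ i)).
have uP i : is_weak_partial i u (g i).
  exact: weak_partial_closed Su (gP i) (fun N => SP N i).
have sqcvg0 (f : R^nat) :
    f @ \oo --> (0 : R) -> (fun k => f k ^+ 2) @ \oo --> (0 : R).
  by move=> f0; under eq_fun do rewrite expr2; rewrite -(mul0r 0); exact: cvgM.
split.
  apply: (H10_closed hpsi); first by move=> i; exists (g i).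
  have cQ : (fun N => H1sqnorm (S N - u)) @ \oo --> (0 : R).
    have -> : (fun N => H1sqnorm (S N - u)) =
      (fun N => L2norm (S N - u) ^+ 2 + \sum_i L2norm (SG N i - g i) ^+ 2).
      apply/funext => N; congr (_ + _).
      by rewrite (grad_sqnormE hpsi (fun i => weak_partialB (SP N i) (uP i))).
    have z : 0 + \sum_(i < n) (0 : R) = 0 by rewrite big1// addr0.
    have h : (fun N => L2norm (S N - u) ^+ 2 +
        \sum_i L2norm (SG N i - g i) ^+ 2) @ \oo --> 0 + \sum_(i < n) (0 : R).
      apply: cvgD; first exact: sqcvg0.
      by apply: cvg_sumr => i _; apply: sqcvg0; exact: gP.
    by rewrite z in h.
  move=> e e0; have /cvgr0Pnorm_lt/(_ _ e0)[N _ /(_ N (leqnn N)) /=] := cQ.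
  rewrite ger0_norm ?H1sqnorm_ge0// => h; exists (S N); split=> //.
  by apply: (H10_sum hpsi) => m; exact: eigen_H10 hpsi m.
apply/(nneseries_EFinP _ (term_ge0 u)).
rewrite (grad_sqnormE hpsi uP).
have -> : (fun N => \sum_(m < N) lam m * ip u (psi m) ^+ 2) =
    (fun N => \sum_i L2norm (SG N i) ^+ 2).
  by apply/funext => N; rewrite (orth_sum_sqnorm G_orth).
apply: cvg_sumr => i _; under eq_fun do rewrite expr2; rewrite expr2.
by apply: cvgM; exact: L2cvg_norm (gP i).
Qed.

Lemma dirichlet_energyE mu u : 0 < mu ->
  ((mu * grad_sqnorm u)%:E + chi H10 u =
   mu%:E * \sum_(0 <= m <oo) (lam m * ip u (psi m) ^+ 2)%:E)%E.
Proof.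
move=> mu0; rewrite /chi; case: ifPn => [/set_mem uH|uH].
  have [|_ ->] := @finite_energy_H10 u; last by rewrite adde0 EFinM.
  apply: (@le_lt_trans _ _ (grad_sqnorm u)%:E); last exact: ltry.
  apply: nneseries_EFin_le => [m|N]; first exact: term_ge0.
  by rewrite big_mkord; exact: dirichlet_bessel.
have [/finite_energy_H10[uH' _]|] :=
  boolP (\sum_(0 <= m <oo) (lam m * ip u (psi m) ^+ 2)%:E < +oo)%E.
  by move: uH; rewrite notin_setE => /(_ uH').
by rewrite -leNgt leye_eq => /eqP ->; rewrite gt0_muley// addey.
Qed.

End dirichlet_energy.

Theorem proposition6p1 (R : realType) (n : nat) (Omega : lipschitz_domain R n)
    (psi : nat -> L2 Omega) (lam : nat -> R) (mu : R)
    (hpsi : dirichlet_eigenbasis psi lam) (hmu : 0 < mu)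
    (s : R) (hs : 0 <= s <= 1) :
  mosco_lim_at (frac_energy psi lam mu) s
    (fun u =>
      if s == 0 then (mu * L2norm u ^+ 2)%:E
      else if s == 1 then ((mu * grad_sqnorm u)%:E + chi H10 u)%E
      else frac_energy psi lam mu s u).
Proof.
have -> : (fun u => if s == 0 then (mu * L2norm u ^+ 2)%:E
      else if s == 1 then ((mu * grad_sqnorm u)%:E + chi H10 u)%E
      else frac_energy psi lam mu s u) = spectral_energy psi lam mu s.
  apply/funext => u; rewrite /spectral_energy; case: ifPn => [/eqP ->|_].
    rewrite EFinM -(parseval hpsi); congr (_ * _)%E.
    by apply: eq_eseriesr => m _; rewrite powRr0 mul1r.
  case: ifPn => [/eqP ->|_]; last exact: frac_energyE.
  rewrite (dirichlet_energyE hpsi u hmu); congr (_ * _)%E.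
  by apply: eq_eseriesr => m _; rewrite powRr1// ltW// (eigenvalue_gt0 hpsi).
exact: spectral_mosco.
Qed.
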